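(* Let $\psi(t):\mathcal{M}\to\mathcal{M}$, $0\le t<T$, be a smooth family of diffeomorphisms that solves the harmonic map heat flow $$\psi_t=\tfrac1\alpha\,\Delta_{g(t),m}\psi\quad\text{in }\mathcal{M}\times(0,T),\qquad g(t):=x(t)^*\mathfrak{e}.$$ Let $\Gamma(t)=x(\mathcal{M},t)$, $0\le t<T$, be the moving embedded submanifold in $\mathbb{R}^n$, with velocity field $v$ given by $v\circ x=x_t$. Then the map $\hat x(t):\mathcal{M}\to\Gamma(t)$, $0\le t<T$, defined by $\hat x(t):=(\psi(t)^{-1})^*x(t)=x(t)\circ\psi(t)^{-1}$, satisfies $$\hat x_t=v\circ\hat x-\tfrac1\alpha\,\nabla\hat x(w)\quad\text{in }\mathcal{M}\times(0,T),$$ where $w=w(t)$ is the tangent vector field on $\mathcal{M}$ whose components $W^k$ with respect to a coordinate chart $\mathcal{C}$ of $\mathcal{M}$, i.e. $w\circ\mathcal{C}^{-1}=W^k\frac{\partial\mathcal{C}^{-1}}{\partial\theta^k}$, are $$W^k:=\hat g^{ij}\big(\Gamma(m)^k_{ij}-\Gamma(\hat g)^k_{ij}\big),$$ and $\Gamma(\hat g)^k_{ij}$, $\Gamma(m)^k_{ij}$ denote the Christoffel symbols of the metrics $\hat g(t):=\hat x(t)^*\mathfrak{e}$ and $m$, respectively.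
   Context: Setting: $(\mathcal{M},m)$ is an $(n-d)$-dimensional compact connected smooth Riemannian manifold with boundary $\partial\mathcal{M}$; $m$ is time-independent. $\mathfrak{e}$ is the Euclidean metric of $\mathbb{R}^n$. $x:\mathcal{M}\times[0,T)\to\mathbb{R}^n$ is smooth and each $x(t)=x(\cdot,t)$ is an embedding with $\Gamma(t)=x(\mathcal{M},t)$ and $\partial\Gamma(t)=x(\partial\mathcal{M},t)$. Let $\Omega=\bigcup_{t\in[0,T)}\Gamma(t)\times\{t\}$. The velocity field $v:\Omega\to\mathbb{R}^n$ is defined by $v\circ x=x_t$, i.e. $v(x(p,t),t)=x_t(p,t)$; similarly $v\circ\hat x$ means $v(\hat x(p,t),t)$. $\alpha>0$ is a constant. Repeated indices are summed. For a metric $h$ with components $h_{ij}$ in a chart with coordinates $\theta$, $h^{ij}$ is the inverse matrix and $\Gamma(h)^k_{ij}=\frac12h^{kl}(\partial_{\theta^i}h_{lj}+\partial_{\theta^j}h_{li}-\partial_{\theta^l}h_{ij})$. $\nabla\hat x$ is the differential of $\hat x(t)$; in local coordinates $\nabla\hat x(w)\circ\mathcal{C}^{-1}=W^k\frac{\partial\hat X}{\partial\theta^k}$ with $\hat X=\hat x\circ\mathcal{C}^{-1}$. The map Laplacian of $\psi:(\mathcal{M},g)\to(\mathcal{M},m)$ is defined, in charts $\mathcal{C}_1$ (domain, indices $i,j,k$) and $\mathcal{C}_2$ (target, indices $\kappa,\beta,\gamma$) with $\Psi=\mathcal{C}_2\circ\psi\circ\mathcal{C}_1^{-1}$, as the vector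 field along $\psi$ with components $$(\Delta_{g,m}\psi)^\kappa=g^{ij}\Big(\frac{\partial^2\Psi^\kappa}{\partial\theta^i\partial\theta^j}-\Gamma(g)^k_{ij}\frac{\partial\Psi^\kappa}{\partial\theta^k}+\Gamma(m)^\kappa_{\beta\gamma}\circ\Psi\,\frac{\partial\Psi^\beta}{\partial\theta^i}\frac{\partial\Psi^\gamma}{\partial\theta^j}\Big).$$ *)

(* Defs.v *)
(* R^k is ['rV[R]_k]; a partial function is a total function that is only ever
   evaluated on the relevant set. *)
From HB Require Import structures.
From mathcomp Require Import all_boot all_order all_algebra.
From mathcomp Require Import all_classical all_reals all_analysis.

Set Implicit Arguments.
Unset Strict Implicit.
Unset Printing Implicit Defensive.

Import Order.TTheory GRing.Theory Num.Theory numFieldNormedType.Exports.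

Local Open Scope classical_set_scope.
Local Open Scope ring_scope.

Section Calculus.
Context {R : realType}.

(* The difference quotient is only taken at points of [A]: one-sided at the
   boundary of a half-space or at an end point of an interval, and equal to
   ['D_v f a] at interior points of [A]. *)
Definition derive_within (V W : normedModType R) (A : set V) (f : V -> W)
    (a v : V) : W :=
  lim ((fun h : R => h^-1 *: (f (h *: v + a) - f a))
         @ within [set h : R | A (h *: v + a)] (0 : R)^').

Definition pderiv (k : nat) (W : normedModType R) (A : set 'rV[R]_k)
    (i : 'I_k) (f : 'rV[R]_k -> W) (a : 'rV[R]_k) : W :=
  derive_within A f a (delta_mx 0 i).

(* Row [i] is the [i]-th partial derivative, so tangent row vectors are mapped
   by multiplication on the right. *)
Definition jacobian (k l : nat) (A : set 'rV[R]_k)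
    (f : 'rV[R]_k -> 'rV[R]_l) (a : 'rV[R]_k) : 'M[R]_(k, l) :=
  \matrix_(i, j) (pderiv A i f a) 0 j.

Fixpoint differentiable_upto (V W : normedModType R) (r : nat) (O : set V)
    (f : V -> W) : Prop :=
  if r is r'.+1 then
    (forall a, O a -> differentiable f a) /\
    (forall v : V, differentiable_upto r' O ('D_v f))
  else True.

(* Smoothness on a set that need not be open (a relatively open part of a
   half-space, possibly times a half-open time interval): locally there is a
   smooth extension to an open set of the ambient space. *)
Definition smooth_on (V W : normedModType R) (A : set V) (f : V -> W) : Prop :=
  forall a, A a -> exists (O : set V) (F : V -> W),
    [/\ open O, O a, forall r, differentiable_upto r O F &
        forall b, A b -> O b -> F b = f b].

End Calculus.

(* The first coordinate is nonnegative; all of R^0 when [k = 0]. *)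
Definition half_space (R : realType) (k : nat) : set 'rV[R]_k :=
  [set u | forall i : 'I_k, i = 0%N :> nat -> 0 <= u 0 i].

Arguments half_space {R k}.

Record chart (R : realType) (k : nat) (M : Type) := Chart {
  cdom : set M;
  cmap : M -> 'rV[R]_k;
  cinv : 'rV[R]_k -> M }.

Section Charts.
Context {R : realType} {k : nat} {M : topologicalType}.
Implicit Types C : chart R k M.

Definition cimg C : set 'rV[R]_k := cmap C @` cdom C.

Definition is_chart C : Prop :=
  [/\ open (cdom C),
      exists2 O : set 'rV[R]_k, open O & cimg C = O `&` half_space,
      forall p, cdom C p -> cinv C (cmap C p) = p,
      {within cdom C, continuous (cmap C)} &
      {within cimg C, continuous (cinv C)}].

Definition overlap C1 C2 : set 'rV[R]_k := cmap C1 @` (cdom C1 `&` cdom C2).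

Definition transition C1 C2 : 'rV[R]_k -> 'rV[R]_k := cmap C2 \o cinv C1.

Definition compatible C1 C2 : Prop :=
  smooth_on (overlap C1 C2) (transition C1 C2) /\
  smooth_on (overlap C2 C1) (transition C2 C1).

End Charts.

(* Smooth manifolds with (possibly empty) boundary. *)
Record manifold (R : realType) (k : nat) := Manifold {
  carrier :> topologicalType;
  atlas : set (chart R k carrier);
  manifold_hausdorff : hausdorff_space carrier;
  manifold_second_countable : @second_countable carrier;
  atlas_chart : forall C, atlas C -> is_chart C;
  atlas_cover : forall p : carrier, exists2 C, atlas C & cdom C p;
  atlas_compatible : forall C1 C2, atlas C1 -> atlas C2 -> compatible C1 C2;
  atlas_maximal : forall C, is_chart C ->
    (forall C', atlas C' -> compatible C C') -> atlas C }.

Arguments atlas {R k} M : rename.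

Section SmoothMaps.
Context {R : realType} {k : nat}.

Definition smooth_map (M N : manifold R k) (f : M -> N) : Prop :=
  continuous f /\
  forall C1 C2, atlas M C1 -> atlas N C2 ->
    smooth_on [set u | cimg C1 u /\ cdom C2 (f (cinv C1 u))]
              (cmap C2 \o f \o cinv C1).

Definition diffeomorphism (M N : manifold R k) (f : M -> N) (g : N -> M) : Prop :=
  [/\ smooth_map f, smooth_map g, cancel f g & cancel g f].

(* [f : M x I -> N] is smooth, written [f t p] with the time first. *)
Definition smooth_family (M N : manifold R k) (I : set R) (f : R -> M -> N) : Prop :=
  {within [set z : M * R | I z.2], continuous (fun z : M * R => f z.2 z.1)} /\
  forall C1 C2, atlas M C1 -> atlas N C2 ->
    smooth_on [set z : 'rV[R]_k * R |
                 [/\ cimg C1 z.1, I z.2 & cdom C2 (f z.2 (cinv C1 z.1))]]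
              (fun z : 'rV[R]_k * R => cmap C2 (f z.2 (cinv C1 z.1))).

Definition smooth_family_Rn (n : nat) (M : manifold R k) (I : set R)
    (x : R -> M -> 'rV[R]_n) : Prop :=
  forall C, atlas M C ->
    smooth_on [set z : 'rV[R]_k * R | cimg C z.1 /\ I z.2]
              (fun z : 'rV[R]_k * R => x z.2 (cinv C z.1)).

(* Smooth immersion that is a homeomorphism onto its image. *)
Definition smooth_embedding (n : nat) (M : manifold R k)
    (x : M -> 'rV[R]_n) : Prop :=
  [/\ forall C, atlas M C -> smooth_on (cimg C) (x \o cinv C),
      forall C u, atlas M C -> cimg C u ->
        row_free (jacobian (cimg C) (x \o cinv C) u),
      injective x,
      continuous x &
      forall U : set M, open U ->
        exists2 V : set 'rV[R]_n, open V & x @` U = V `&` range x].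

End SmoothMaps.

Section RiemannianGeometry.
Context {R : realType} {k : nat}.

(* A tensor field is the family of its component functions in all charts: a
   covariant 2-tensor [h] has components [h C u i j] at the point [u] of
   [cimg C], and a vector field [w] has components [w C p 0 i] at [p]. *)
Definition cotensor2 (M : manifold R k) := chart R k M -> 'rV[R]_k -> 'M[R]_k.
Definition vector_components (M : manifold R k) :=
  chart R k M -> M -> 'rV[R]_k.

Definition riemannian_metric (M : manifold R k) (h : cotensor2 M) : Prop :=
  [/\ forall C, atlas M C -> smooth_on (cimg C) (h C),
      forall C u, atlas M C -> cimg C u -> (h C u)^T = h C u,
      forall C u (a : 'rV[R]_k), atlas M C -> cimg C u -> a != 0 ->
        0 < (a *m h C u *m a^T) 0 0 &
      forall C1 C2 p, atlas M C1 -> atlas M C2 -> cdom C1 p -> cdom C2 p ->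
        let J := jacobian (overlap C1 C2) (transition C1 C2) (cmap C1 p) in
        h C1 (cmap C1 p) = J *m h C2 (cmap C2 p) *m J^T].

Definition tangent_field (M : manifold R k) (w : vector_components M) : Prop :=
  forall C1 C2 p, atlas M C1 -> atlas M C2 -> cdom C1 p -> cdom C2 p ->
    w C2 p =
      w C1 p *m jacobian (overlap C1 C2) (transition C1 C2) (cmap C1 p).

(* The pull-back of the Euclidean metric. *)
Definition pullback_euclidean (n : nat) (M : manifold R k)
    (x : M -> 'rV[R]_n) : cotensor2 M :=
  fun C u => \matrix_(i, j) \sum_(l < n)
    (pderiv (cimg C) i (x \o cinv C) u) 0 l *
    (pderiv (cimg C) j (x \o cinv C) u) 0 l.

(* The component with upper index [c] and lower indices [i, j]. *)
Definition christoffel (A : set 'rV[R]_k) (h : 'rV[R]_k -> 'M[R]_k)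
    (u : 'rV[R]_k) (c i j : 'I_k) : R :=
  2^-1 * \sum_(l < k) invmx (h u) c l *
    (pderiv A i (fun y => h y l j) u + pderiv A j (fun y => h y l i) u
     - pderiv A l (fun y => h y i j) u).

(* The components, in the chart [C2] around [f p], of the map Laplacian at [p]
   of [f : (M, g) -> (N, h)], computed in the chart [C1] around [p]. *)
Definition map_laplacian (M N : manifold R k) (g : cotensor2 M)
    (h : cotensor2 N) (f : M -> N) (C1 : chart R k M) (C2 : chart R k N)
    (p : M) : 'rV[R]_k :=
  let A := [set u | cimg C1 u /\ cdom C2 (f (cinv C1 u))] in
  let F (b : 'I_k) (u : 'rV[R]_k) : R := cmap C2 (f (cinv C1 u)) 0 b in
  let u := cmap C1 p in
  \row_c \sum_(i < k) \sum_(j < k) invmx (g C1 u) i j *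
    (pderiv A i (pderiv A j (F c)) u
     - \sum_(l < k) christoffel (cimg C1) (g C1) u l i j * pderiv A l (F c) u
     + \sum_(a < k) \sum_(b < k)
         christoffel (cimg C2) (h C2) (cmap C2 (f p)) c a b *
         pderiv A i (F a) u * pderiv A j (F b) u).

Definition harmonic_map_heat_flow (M N : manifold R k) (alpha : R)
    (I : set R) (g : R -> cotensor2 M) (h : cotensor2 N)
    (f : R -> M -> N) : Prop :=
  forall t p C1 C2, I t -> atlas M C1 -> atlas N C2 ->
    cdom C1 p -> cdom C2 (f t p) ->
    'D_1 (fun s : R => cmap C2 (f s p)) t =
      alpha^-1 *: map_laplacian (g t) h (f t) C1 C2 p.

(* The vector field with components g^{ij} (Gamma(h)^c_{ij} - Gamma(g)^c_{ij}). *)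
Definition deturck_field (M : manifold R k) (g h : cotensor2 M) :
    vector_components M :=
  fun C p => let u := cmap C p in
  \row_c \sum_(i < k) \sum_(j < k) invmx (g C u) i j *
    (christoffel (cimg C) (h C) u c i j - christoffel (cimg C) (g C) u c i j).

(* The differential of [x] applied to [w], computed in the chart [C]. *)
Definition differential_apply (n : nat) (M : manifold R k)
    (x : M -> 'rV[R]_n) (w : vector_components M) (C : chart R k M) (p : M) :
    'rV[R]_n :=
  \sum_(i < k) w C p 0 i *: pderiv (cimg C) i (x \o cinv C) (cmap C p).

End RiemannianGeometry.

(* [0, T) and (0, T); the final time [T] may be infinite. *)
Definition time_co (R : realType) (T : \bar R) : set R :=
  [set t | 0 <= t /\ (t%:E < T)%E].
Definition time_oo (R : realType) (T : \bar R) : set R :=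
  [set t | 0 < t /\ (t%:E < T)%E].

(* [v] is only constrained on the space-time track of [x]. *)
Definition velocity_field (R : realType) (k n : nat) (M : manifold R k)
    (I : set R) (x : R -> M -> 'rV[R]_n)
    (v : 'rV[R]_n -> R -> 'rV[R]_n) : Prop :=
  forall t p, I t -> v (x t p) t = derive_within I (fun s : R => x s p) t 1.

(* Main.v *)
From HB Require Import structures.
From mathcomp Require Import all_boot all_order all_algebra.
From mathcomp Require Import all_classical all_reals all_analysis.
From mathcomp Require Import ring lra.
Require Import Defs.

Set Implicit Arguments.
Unset Strict Implicit.
Unset Printing Implicit Defensive.

Import Order.TTheory GRing.Theory Num.Theory numFieldNormedType.Exports.

Local Open Scope classical_set_scope.
Local Open Scope ring_scope.

(** The theorem combines an identity between two vector fields with the chain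
    rule in time.

    The identity: let [Psi] be the expression of a diffeomorphism [f] in charts,
    [J] its Jacobian matrix (rows are partial derivatives), [h] a metric on the
    target and [g = J h J^T] its pull-back. Differentiating this product and
    using the symmetry of second derivatives gives the inhomogeneous law
    [Gamma(g)^l_ij d_l Psi^c
       = d_i d_j Psi^c + Gamma(h)^c_ab d_i Psi^a d_j Psi^b]
    ([christoffel_pullback]). In the map Laplacian of [f] from [g] to [m] the
    second derivatives therefore cancel, and since [J^T g^-1 J = h^-1] what is
    left is [h^ab (Gamma(m)^c_ab - Gamma(h)^c_ab)] at the image point: the map
    Laplacian of [f] is the DeTurck field of [h] and [m] along [f]
    ([map_laplacian_deturck]). The same cancellation for the identity map in two
    charts shows that the DeTurck field is a tangent vector field
    ([deturck_tangent]). Here [f = psi t], [h = ghat t] and [g] is the metric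
    induced by [x t = xhat t \o psi t].

    The time derivative: only the flow [psi] is smooth in time by assumption,
    not its inverse. Write [q s = psi_inv s p] and [u s] for its coordinates.
    Compactness of the manifold makes [q] continuous in [s]
    ([inverse_family_cvg]); differentiating [psi s (q s) = p] then forces [u] to
    be differentiable, with derivative [- (d_s psi) J^-1]
    ([implicit_derivative]). By the flow equation [d_s psi] is [alpha^-1] times
    the DeTurck field [w], so the chain rule for [xhat s p = x s (q s)] yields
    the velocity [v] plus the differential of [x t] at
    [- alpha^-1 w J^-1]. As [x t = xhat t \o psi t], the latter is
    [- alpha^-1] times the differential of [xhat t] at [w].

    Charts take values in a half-space, so derivatives at the boundary are
    one-sided. They are all handled through [diff_within]: near the point the
    function agrees on the domain with one that is differentiable in the
    ordinary sense, and its partial derivatives are those of any such extension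
    ([pderiv_ext]). *)

(** * Differentiability relative to a subset *)

Lemma near_everywhere (V : topologicalType) (a : V) (P : V -> Prop) :
  (forall b, P b) -> \forall b \near a, P b.
Proof. by move=> HP; exact: filterE. Qed.

Section DifferentiabilityWithin.
Context {R : realType}.

(** Differentiability at one point only, through a local extension that may depend
    on the point. It passes to compositions, sums and products, and a second
    derivative is obtained by applying it to the partial derivatives on [A], where
    the chain rule expresses those of a composite. *)
Definition diff_within (V W : normedModType R) (A : set V) (f : V -> W)
    (a : V) : Prop :=
  exists2 F : V -> W, differentiable F a & \forall b \near a, A b -> F b = f b.

(** Neighbourhood form of being the trace of an open set on the half-space. *)
Definition rel_open (k : nat) (A : set 'rV[R]_k) : Prop :=
  A `<=` half_space /\
  forall a, A a -> \forall b \near a, half_space b -> A b.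

Lemma near_line (V : normedModType R) (a v : V) (P : set V) :
  (\forall b \near a, P b) -> \forall h \near (0 : R), P (h *: v + a).
Proof.
move=> Pa.
have h0 : (fun h : R => h *: v + a) h @[h --> 0] --> a.
  rewrite -[X in _ --> X]add0r -(scale0r v).
  by apply: cvgD; [apply: cvgZr_tmp; exact: cvg_id|exact: cvg_cst].
exact: h0.
Qed.

(** The hypothesis on the filter says that [a] can be approached inside [A] along
    [v]; it makes the limit defining [derive_within] unique. *)
Lemma derive_within_ext (V W : normedModType R) (A : set V) (F f : V -> W)
    (a v : V) :
  ProperFilter (within [set h : R | A (h *: v + a)] (0 : R)^') ->
  A a -> differentiable F a -> (\forall b \near a, A b -> F b = f b) ->
  derive_within A f a v = 'd F a v.
Proof.
move=> PF Aa dF Ff; rewrite -deriveE//.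
have Fa : F a = f a by exact: (nbhs_singleton Ff).
apply: cvg_lim => //.
have := diff_derivable (v := v) dF.
move=> /cvgP; rewrite -/('D_v F a) => cF.
have cFw : (fun h : R => h^-1 *: (F (h *: v + a) - F a))
    @ within [set h : R | A (h *: v + a)] (0 : R)^' --> 'D_v F a.
  by apply: cvg_trans cF; apply: cvg_app; exact: cvg_within.
apply: cvg_trans cFw; apply: near_eq_cvg.
have /(@nbhs_dnbhs _ (0 : R)) hn := near_line v Ff.
rewrite near_withinE.
by apply: filterS hn => h Fh Ah; rewrite Fa Fh.
Qed.

(** In a half-space every coordinate direction can be followed in the positive
    sense, even from a boundary point. *)
Lemma rel_open_approached (k : nat) (A : set 'rV[R]_k) (a : 'rV[R]_k)
    (i : 'I_k) : rel_open A -> A a ->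
  ProperFilter (within [set h : R | A (h *: delta_mx 0 i + a)] (0 : R)^').
Proof.
move=> [AH Ao] Aa; apply: Build_ProperFilter => nP.
have nA := near_line (delta_mx 0 i) (Ao _ Aa).
have nA' : \forall h \near (0 : R)^'+, h > 0 /\
    (half_space (h *: delta_mx 0 i + a) -> A (h *: delta_mx 0 i + a)).
  rewrite near_withinE.
  by apply: filterS nA => h Ah h0; split.
have nP' : \forall h \near (0 : R)^'+, A (h *: delta_mx 0 i + a) -> False.
  have {}nP : \forall h \near (0 : R)^', A (h *: delta_mx 0 i + a) -> False.
    exact: nP.
  move: nP; rewrite !near_withinE; apply: filterS => h Ph h0; apply: Ph.
  by rewrite gt_eqF.
have [h [[h0 Ah] Ph]] := filter_ex (filterI nA' nP').
apply: Ph; apply: Ah => j j0; rewrite !mxE/=.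
by rewrite addr_ge0// ?mulr_ge0 ?ler0n ?(ltW h0)//; exact: (AH _ Aa).
Qed.

Lemma pderiv_ext (k : nat) (W : normedModType R) (A : set 'rV[R]_k)
    (F f : 'rV[R]_k -> W) (a : 'rV[R]_k) (i : 'I_k) :
  rel_open A -> A a -> differentiable F a ->
  (\forall b \near a, A b -> F b = f b) ->
  pderiv A i f a = 'd F a (delta_mx 0 i).
Proof.
by move=> Ao Aa dF Ff; apply: derive_within_ext => //; exact: rel_open_approached.
Qed.

Lemma diff_rV (k : nat) (W : normedModType R) (F : 'rV[R]_k -> W)
    (a h : 'rV[R]_k) :
  'd F a h = \sum_i h 0 i *: 'd F a (delta_mx 0 i).
Proof.
rewrite {1}[h]row_sum_delta linear_sum; apply: eq_bigr => i _.
by rewrite linearZ.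
Qed.

Lemma diff_within_comp (U V W : normedModType R) (A : set U) (B : set V)
    (g : U -> V) (f : V -> W) (a : U) :
  A a -> (\forall b \near a, A b -> B (g b)) ->
  diff_within A g a -> diff_within B f (g a) -> diff_within A (f \o g) a.
Proof.
move=> Aa AB [G dG Gg] [F dF Ff].
have Ga : G a = g a by exact: (nbhs_singleton Gg).
exists (F \o G); first by apply: differentiable_comp => //; rewrite Ga.
have cG : G b @[b --> a] --> g a by rewrite -Ga; exact: differentiable_continuous.
have FfG : \forall b \near a, B (G b) -> F (G b) = f (G b) := cG _ Ff.
apply: filterS3 AB Gg FfG => b ABb Gb FGb Ab /=.
by rewrite FGb Gb//; exact: ABb.
Qed.

Lemma diff_within_local (V W : normedModType R) (A B : set V) (f g : V -> W)
    (a : V) :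
  (\forall b \near a, A b -> B b /\ f b = g b) ->
  diff_within B f a -> diff_within A g a.
Proof.
move=> AB [F dF Ff]; exists F => //.
by apply: filterS2 AB Ff => b ABb Fb /ABb[/Fb -> <-].
Qed.

Lemma pderiv_local (k : nat) (W : normedModType R) (A B : set 'rV[R]_k)
    (f g : 'rV[R]_k -> W) (a : 'rV[R]_k) (i : 'I_k) :
  rel_open A -> rel_open B -> A a -> B a ->
  (\forall b \near a, A b -> B b /\ f b = g b) ->
  diff_within B f a -> pderiv A i g a = pderiv B i f a.
Proof.
move=> Ao Bo Aa Ba AB [F dF Ff].
rewrite (pderiv_ext i Bo Ba dF Ff) (pderiv_ext i Ao Aa dF)//.
by apply: filterS2 AB Ff => b ABb Fb /ABb[/Fb -> <-].
Qed.

(** This is the ordinary chain rule for the extensions, wherever [g] sends the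
    boundary points of [A]. *)
Lemma pderiv_comp (k l : nat) (W : normedModType R) (A : set 'rV[R]_k)
    (B : set 'rV[R]_l) (g : 'rV[R]_k -> 'rV[R]_l) (f : 'rV[R]_l -> W)
    (a : 'rV[R]_k) (i : 'I_k) :
  rel_open A -> rel_open B -> A a -> (forall b, A b -> B (g b)) ->
  diff_within A g a -> diff_within B f (g a) ->
  pderiv A i (f \o g) a =
  \sum_j (pderiv A i g a) 0 j *: pderiv B j f (g a).
Proof.
move=> Ao Bo Aa AB [G dG Gg] [F dF Ff].
have Ga : G a = g a by exact: (nbhs_singleton Gg).
have cG : G b @[b --> a] --> g a by rewrite -Ga; exact: differentiable_continuous.
rewrite (pderiv_ext (F := F \o G) i Ao Aa); last 2 first.
- by apply: differentiable_comp => //; rewrite Ga.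
- have FfG : \forall b \near a, B (G b) -> F (G b) = f (G b) := cG _ Ff.
  apply: filterS2 Gg FfG => b Gb FGb Ab /=.
  by rewrite FGb Gb//; exact: AB.
rewrite diff_comp//=; last by rewrite Ga.
rewrite diff_rV; apply: eq_bigr => j _.
by rewrite (pderiv_ext i Ao Aa dG Gg) (pderiv_ext j Bo (AB _ Aa) dF Ff) Ga.
Qed.

Lemma diff_within_coord (V : normedModType R) (m n : nat) (A : set V)
    (f : V -> 'M[R]_(m, n)) (a : V) (i : 'I_m) (j : 'I_n) :
  diff_within A f a -> diff_within A (fun u => f u i j) a.
Proof.
move=> [F dF Ff]; exists (fun u => F u i j).
  exact: (differentiable_comp dF (differentiable_coord _ _ _)).
by apply: filterS Ff => b Fb Ab; rewrite Fb.
Qed.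

Lemma diff_coord (V : normedModType R) (m n : nat) (F : V -> 'M[R]_(m, n))
    (a h : V) (i : 'I_m) (j : 'I_n) :
  differentiable F a -> 'd (fun u => F u i j) a h = 'd F a h i j.
Proof.
move=> dF.
have dFij : differentiable (fun u => F u i j) a.
  exact: (differentiable_comp dF (differentiable_coord _ _ _)).
rewrite -!deriveE// derive_mx ?mxE//; exact: diff_derivable.
Qed.

Lemma pderiv_coord (k m n : nat) (A : set 'rV[R]_k)
    (f : 'rV[R]_k -> 'M[R]_(m, n)) (a : 'rV[R]_k) (c : 'I_k) i j :
  rel_open A -> A a -> diff_within A f a ->
  pderiv A c (fun u => f u i j) a = pderiv A c f a i j.
Proof.
move=> Ao Aa [F dF Ff].
rewrite (pderiv_ext c Ao Aa dF Ff) -diff_coord//; apply: pderiv_ext => //.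
  exact: (differentiable_comp dF (differentiable_coord _ _ _)).
by apply: filterS Ff => b Fb Ab; rewrite Fb.
Qed.

Lemma diff_withinM (V : normedModType R) (A : set V) (f g : V -> R) (a : V) :
  diff_within A f a -> diff_within A g a ->
  diff_within A (fun u => f u * g u) a.
Proof.
move=> [F dF Ff] [G dG Gg]; exists (fun u => F u * G u).
  exact: differentiableM.
by apply: filterS2 Ff Gg => b Fb Gb Ab; rewrite Fb// Gb.
Qed.

Lemma diff_within_sum (V : normedModType R) (A : set V) (n : nat)
    (f : 'I_n -> V -> R) (a : V) :
  (forall i, diff_within A (f i) a) ->
  diff_within A (fun u => \sum_(i < n) f i u) a.
Proof.
move=> /(_ _)/cid2-/all_sig2[F dF Ff].
exists (\sum_(i < n) F i); first exact: differentiable_sum.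
have : \forall b \near a, forall i, A b -> F i b = f i b.
  exact: filter_forall.
apply: filterS => b Fb Ab; rewrite fct_sumE; apply: eq_bigr => i _.
exact: Fb.
Qed.

Lemma pderivM (k : nat) (A : set 'rV[R]_k) (f g : 'rV[R]_k -> R)
    (a : 'rV[R]_k) (i : 'I_k) :
  rel_open A -> A a -> diff_within A f a -> diff_within A g a ->
  pderiv A i (fun u => f u * g u) a =
  f a * pderiv A i g a + g a * pderiv A i f a.
Proof.
move=> Ao Aa [F dF Ff] [G dG Gg].
rewrite (pderiv_ext i Ao Aa dF Ff) (pderiv_ext i Ao Aa dG Gg).
rewrite (pderiv_ext (F := fun u => F u * G u) i Ao Aa); last 2 first.
- exact: differentiableM.
- by apply: filterS2 Ff Gg => b Fb Gb Ab; rewrite Fb// Gb.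
rewrite (diffM dF dG)/=.
by rewrite (nbhs_singleton Ff)// (nbhs_singleton Gg).
Qed.

Lemma pderiv_sum (k n : nat) (A : set 'rV[R]_k) (f : 'I_n -> 'rV[R]_k -> R)
    (a : 'rV[R]_k) (i : 'I_k) :
  rel_open A -> A a -> (forall j, diff_within A (f j) a) ->
  pderiv A i (fun u => \sum_(j < n) f j u) a =
  \sum_(j < n) pderiv A i (f j) a.
Proof.
move=> Ao Aa /(_ _)/cid2-/all_sig2[F dF Ff].
have Ff' : \forall b \near a, forall j, A b -> F j b = f j b.
  exact: (@filter_forall _ _ (fun j b => A b -> F j b = f j b)) Ff.
rewrite (pderiv_ext (F := \sum_(j < n) F j) i Ao Aa); last 2 first.
- exact: differentiable_sum.
- apply: filterS Ff' => b Fb Ab; rewrite fct_sumE; apply: eq_bigr => j _.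
  exact: Fb.
rewrite -deriveE; last exact: differentiable_sum.
rewrite derive_sum; last by move=> j; exact: diff_derivable.
by apply: eq_bigr => j _; rewrite (pderiv_ext i Ao Aa (dF j) (Ff j)) deriveE.
Qed.

End DifferentiabilityWithin.

(** * Symmetry of second derivatives *)

Section SecondDerivatives.
Context {R : realType}.

Lemma diff_remainder (V W : normedModType R) (F : V -> W) (a : V) (e : R) :
  differentiable F a -> 0 < e ->
  \forall y \near (0 : V), `|F (y + a) - F a - 'd F a y| <= e * `|y|.
Proof.
move=> /diff_locally /eqaddoP /(_ e) dF e0.
by apply: filterS (dF e0) => y /=; rewrite opprD addrA.
Qed.

Lemma is_derive_line (V W : normedModType R) (F : V -> W) (v b : V) (s : R) :
  differentiable F (s *: v + b) ->
  is_derive s 1 (fun r : R => F (r *: v + b)) ('D_v F (s *: v + b)).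
Proof.
move=> dF.
have dl : is_diff s (fun r : R => r *: v + b) (fun h : R => h *: v).
  have d1 : is_diff s ( *:%R^~ v + cst b) ( *:%R^~ v + 0).
    exact: is_diffD.
  by move: d1; rewrite addr0.
have dc : is_diff s (F \o (fun r : R => r *: v + b))
    ('d F (s *: v + b) \o (fun h : R => h *: v)).
  by apply: is_diff_comp; exact: differentiableP.
have dc1 : differentiable (F \o (fun r : R => r *: v + b)) s := ex_diff.
apply: DeriveDef; first exact: diff_derivable.
by rewrite [LHS]deriveE// (@diff_val _ _ _ _ _ _ _ dc)/= scale1r deriveE.
Qed.

(** The mean value theorem applied to
    [s |-> F (s v + h w + a) - F (s v + a)] reduces the second difference to
    an increment of ['D_v F]. *)
Lemma second_difference (V : normedModType R) (F : V -> R) (a v w : V) (e : R) :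
  (\forall b \near a, differentiable F b) -> differentiable ('D_v F) a ->
  0 < e ->
  \forall h \near (0 : R)^'+,
    `|F (h *: v + (h *: w + a)) - F (h *: v + a) - F (h *: w + a) + F a
      - h ^+ 2 * 'D_w ('D_v F) a| <= e * h ^+ 2.
Proof.
move=> dF dG e0; set G := 'D_v F in dG *.
pose c := `|v| + `|v| + `|w| + 1.
have c0 : 0 < c by rewrite ltr_wpDl// !addr_ge0.
have dF' : \forall y \near (0 : V), differentiable F (y + a).
  by move: dF; rewrite (near_shift 0 a); apply: filterS => y; rewrite /= subr0.
have /nbhs_norm0P[d /= d0 Hd] :
    \forall y \near (0 : V), differentiable F (y + a) /\
      `|G (y + a) - G a - 'd G a y| <= e / c * `|y|.
  by apply: filterI => //; exact: diff_remainder (divr_gt0 _ _).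
near=> h.
have h0 : 0 < h by [].
have hd : h * c < d.
  rewrite -ltr_pdivlMr//; near: h.
  by apply: nbhs_right_lt; rewrite divr_gt0.
have small s (z : V) : 0 <= s <= h -> `|z| <= h * `|w| -> `|s *: v + z| < d.
  move=> /andP[s0 sh] zw; apply: le_lt_trans hd.
  rewrite (le_trans (ler_normD _ _))// normrZ ger0_norm//.
  rewrite /c !mulrDr mulr1 -!addrA.
  have := ler_wpM2r (normr_ge0 v) sh; have := mulr_ge0 (ltW h0) (normr_ge0 v).
  by lra.
have w1 : `|h *: w| <= h * `|w| by rewrite normrZ gtr0_norm.
have w0 : `|0 : V| <= h * `|w| by rewrite normr0 mulr_ge0// ltW.
pose phi (s : R) := F (s *: v + (h *: w + a)) - F (s *: v + a).
have dphi s : 0 <= s <= h ->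
    is_derive s 1 phi (G (s *: v + (h *: w + a)) - G (s *: v + a)).
  move=> sh; apply: is_deriveB; apply: is_derive_line.
    by rewrite addrA; apply: (Hd _ _).1; exact: small.
  by have := (Hd _ (small _ _ sh w0)).1; rewrite addr0.
have cphi : {within `[0, h], continuous phi}.
  apply: continuous_in_subspaceT => s; rewrite inE/= in_itv/= => sh.
  by apply/differentiable_continuous/derivable1_diffP; have [] := dphi _ sh.
have dphi' s : s \in `]0, h[ ->
    is_derive s 1 phi (G (s *: v + (h *: w + a)) - G (s *: v + a)).
  by rewrite in_itv/= => /andP[s0 sh]; apply: dphi; rewrite !ltW.
have [xi] := MVT h0 dphi' cphi.
rewrite in_itv/= => /andP[xi0 xih].
have xi0h : 0 <= xi <= h by rewrite !ltW.
rewrite /phi scale0r !add0r subr0 => Ephi.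
have HP := (Hd _ (small _ _ xi0h w1)).2.
have HQ := (Hd _ (small _ _ xi0h w0)).2.
have dGZ (s : R) z : 'd G a (s *: z) = s * ('d G a z : R) by rewrite linearZ.
rewrite linearD/= !dGZ -[xi *: v + _ + a]addrA in HP.
rewrite !addr0 dGZ in HQ.
rewrite deriveE//; set D := 'd G a w in HP *; set E := 'd G a v in HP HQ.
set P := G (xi *: v + (h *: w + a)) in Ephi HP; set Q := G _ in Ephi HQ.
rewrite [X in `|X|](_ : _ =
    h * ((P - G a - (xi * E + h * D)) - (Q - G a - xi * E))); last first.
  have rearr (p q r s x : R) : p - q - r + s - x = p - q - (r - s) - x by ring.
  transitivity ((P - Q) * h - h ^+ 2 * D); last by ring.
  by rewrite -Ephi; exact: rearr.
rewrite normrM gtr0_norm// [leRHS](_ : _ = h * (e * h)); last by ring.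
rewrite ler_wpM2l// ?(ltW h0)//.
apply: le_trans (ler_normB _ _) _; apply: le_trans (lerD HP HQ) _.
rewrite -mulrDr mulrAC ler_pdivrMr// -[leRHS]mulrA ler_wpM2l// ?(ltW e0)//.
have := ler_normD (xi *: v) (h *: w); rewrite !normrZ !gtr0_norm//.
have := ler_wpM2r (normr_ge0 v) (ltW xih); rewrite /c; have := ltW h0.
by nra.
Unshelve. all: by end_near. Qed.

(** Both orders of differentiation are limits of the same symmetric second
    difference. *)
Lemma derive_derive_sym (V : normedModType R) (F : V -> R) (a v w : V) :
  (\forall b \near a, differentiable F b) -> differentiable ('D_v F) a ->
  differentiable ('D_w F) a -> 'D_w ('D_v F) a = 'D_v ('D_w F) a.
Proof.
move=> dF dv dw; apply/eqP; rewrite -subr_eq0 -normr_eq0.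
apply/eqP/le_anti; rewrite normr_ge0 andbT; apply/ler_addgt0Pr => e e0.
rewrite add0r.
have e20 : 0 < e / 2 by rewrite divr_gt0.
have [h [h0 [Hv Hw]]] := filter_ex (filterI (nbhs_right_gt 0)
  (filterI (second_difference w dF dv e20) (second_difference v dF dw e20))).
have h20 : 0 < h ^+ 2 by rewrite exprn_gt0.
rewrite -(ler_pM2l h20) -{1}(gtr0_norm h20) -normrM.
move: Hv Hw.
rewrite [h *: w + (h *: v + a)]addrCA.
set X := F _; set Y := F _; set Z := F (_ + a); set D := 'D_w _ _.
set D' := 'D_v _ _ => Hv Hw.
rewrite (_ : _ * _ = (X - Z - Y + F a - h ^+ 2 * D')
  - (X - Y - Z + F a - h ^+ 2 * D)); last by ring.
apply: le_trans (ler_normB _ _) _; apply: le_trans (lerD Hw Hv) _.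
by rewrite -mulrDl -splitr mulrC.
Qed.

Lemma near_eq_differentiable (V W : normedModType R) (f g : V -> W) (a : V) :
  (\forall b \near a, f b = g b) -> differentiable f a -> differentiable g a.
Proof.
move=> fg df; have fga : f a = g a by exact: (nbhs_singleton fg).
have gE : g \o shift a = cst (g a) + 'd f a +o_ 0 id.
  apply/eqaddoP => e e0.
  have fg0 : \forall y \near (0 : V), f (y + a) = g (y + a).
    by move: fg; rewrite (near_shift 0 a); apply: filterS => y; rewrite /= subr0.
  apply: filterS2 fg0 (diff_remainder df e0) => y fgy.
  by rewrite fgy fga /= opprD addrA.
have dgE : ('d g a : V -> W) = 'd f a.
  by apply: diff_unique gE; exact: diff_continuous.
apply/diff_locallyP; rewrite dgE; split=> //; exact: diff_continuous.
Qed.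

Lemma smooth_onW (V W : normedModType R) (A B : set V) (f g : V -> W) :
  (forall a, B a -> A a /\ f a = g a) -> smooth_on A f -> smooth_on B g.
Proof.
move=> BA fA a Ba; have [U [F [oU Ua FU Ff]]] := fA a (BA a Ba).1.
by exists U, F; split=> // b Bb Ub; have [Ab <-] := BA b Bb; exact: Ff.
Qed.

Lemma smooth_on_diff_within (V W : normedModType R) (A : set V) (f : V -> W)
    (a : V) : smooth_on A f -> A a -> diff_within A f a.
Proof.
move=> fA Aa; have [U [F [oU Ua FU Ff]]] := fA a Aa.
exists F; first exact: (FU 1%N).1.
by have := open_nbhs_nbhs (conj oU Ua); apply: filterS => b Ub Ab; exact: Ff.
Qed.

(** The part of smoothness that the symmetry of second derivatives uses, for one
    matrix entry and one point. *)
Lemma smooth_on_coord_ext (V : normedModType R) (m n : nat) (A : set V)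
    (f : V -> 'M[R]_(m, n)) (a : V) (i : 'I_m) (j : 'I_n) :
  smooth_on A f -> A a ->
  exists F : V -> R, [/\ \forall b \near a, differentiable F b,
    forall v, differentiable ('D_v F) a &
    \forall b \near a, A b -> F b = f b i j].
Proof.
move=> fA Aa; have [U [F [oU Ua FU Ff]]] := fA a Aa.
have nU := open_nbhs_nbhs (conj oU Ua).
have cdiff (G : V -> 'M[R]_(m, n)) b : differentiable G b ->
    differentiable (fun u => G u i j) b.
  by move=> dG; exact: (differentiable_comp dG (differentiable_coord _ _ _)).
exists (fun u => F u i j); split.
- by apply: filterS nU => b Ub; apply: cdiff; exact: (FU 1%N).1.
- move=> v.
  have dD : differentiable (fun u => 'D_v F u i j) a.
    by apply: cdiff; exact: ((FU 2%N).2 v).1.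
  apply: near_eq_differentiable dD; apply: filterS nU => b Ub.
  have dFb : differentiable F b by exact: (FU 1%N).1.
  by rewrite !deriveE ?diff_coord//; exact: cdiff.
- by apply: filterS nU => b Ub Ab; rewrite Ff.
Qed.

Lemma pderiv_diff_within (k m n : nat) (A : set 'rV[R]_k)
    (f : 'rV[R]_k -> 'M[R]_(m, n)) (a : 'rV[R]_k) (c : 'I_k) :
  rel_open A -> smooth_on A f -> A a ->
  forall i j, diff_within A (pderiv A c (fun u => f u i j)) a.
Proof.
move=> Ao fA Aa i j.
have [F [dF dDF Ff]] := smooth_on_coord_ext i j fA Aa.
exists ('D_(delta_mx 0 c) F) => //.
near=> b => Ab.
rewrite (pderiv_ext (F := F)) ?deriveE//; near: b => //.
by apply: filterS (near_join Ff).
Unshelve. all: by end_near. Qed.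

Lemma pderiv_sym (k m n : nat) (A : set 'rV[R]_k)
    (f : 'rV[R]_k -> 'M[R]_(m, n)) (a : 'rV[R]_k) (c d : 'I_k) i j :
  rel_open A -> smooth_on A f -> A a ->
  pderiv A c (pderiv A d (fun u => f u i j)) a =
  pderiv A d (pderiv A c (fun u => f u i j)) a.
Proof.
move=> Ao fA Aa.
have [F [dF dDF Ff]] := smooth_on_coord_ext i j fA Aa.
have E l : \forall b \near a, A b -> 'D_(delta_mx 0 l) F b =
    pderiv A l (fun u => f u i j) b.
  near=> b => Ab.
  rewrite (pderiv_ext (F := F)) ?deriveE//; near: b => //.
  by apply: filterS (near_join Ff).
rewrite (pderiv_ext c Ao Aa (dDF _) (E d)) (pderiv_ext d Ao Aa (dDF _) (E c)).
have := derive_derive_sym dF (dDF (delta_mx 0 d)) (dDF (delta_mx 0 c)).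
rewrite (deriveE (delta_mx 0 c) (dDF (delta_mx 0 d))).
rewrite (deriveE (delta_mx 0 d) (dDF (delta_mx 0 c))).
done.
Unshelve. all: by end_near. Qed.

End SecondDerivatives.

(** * Algebra of Christoffel symbols *)

Section ChristoffelAlgebra.
Context {F : numFieldType} {k : nat}.
Implicit Types (J H : 'M[F]_k) (D S : 'I_k -> 'I_k -> 'I_k -> F).

(** The inverse metric transforms as a contravariant tensor. *)
Lemma invmx_pullback J H : J \in unitmx -> H \in unitmx ->
  J^T *m invmx (J *m H *m J^T) *m J = invmx H.
Proof.
move=> Ju Hu; have JTu : J^T \in unitmx by rewrite unitmx_tr.
have Gu : J *m H *m J^T \in unitmx by rewrite !unitmx_mul Ju Hu.
set G := J *m H *m J^T in Gu *.
have XH : J^T *m invmx G *m J *m H = 1%:M.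
  apply: (can_inj (mulmxK JTu)).
  rewrite mul1mx -[RHS](mulmxKV Gu).
  by rewrite [X in _ = _ *m X](_ : G = J *m H *m J^T)// !mulmxA.
by rewrite -[LHS](mulmxK Hu) XH mul1mx.
Qed.

(** Christoffel symbols of the first kind, up to the factor 1/2, as a function of
    the array [D c a b] of first derivatives of the metric. *)
Definition lower_christoffel D (l i j : 'I_k) : F := D i l j + D j l i - D l i j.

Definition upper_christoffel H D (c i j : 'I_k) : F :=
  2^-1 * \sum_l invmx H c l * lower_christoffel D l i j.

(** The derivative in direction [c] of the entry [l, j] of [J H J^T] by the product
    rule, where [S] holds the derivatives of [J] and [D] those of [H]; the inner
    sum over [e] is the chain rule for [H] evaluated along the map. *)
Definition pullback_derivative J H D S (c l j : 'I_k) : F :=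
  \sum_a \sum_b (S c l a * H a b * J j b
    + J l a * (\sum_e J c e * D e a b) * J j b
    + J l a * H a b * S c j b).

(** Of the six terms with second derivatives of the map, four cancel in pairs by
    the symmetry of [S] and the other two coincide. *)
Lemma lower_christoffel_pullback J H D S (l i j : 'I_k) :
  H^T = H -> (forall c d a, S c d a = S d c a) ->
  lower_christoffel (pullback_derivative J H D S) l i j =
  \sum_a J l a * (2 * (\sum_b H a b * S i j b)
    + \sum_p \sum_q J i p * J j q * lower_christoffel D a p q).
Proof.
move=> HT Ssym; rewrite /lower_christoffel.
pose P c d e := \sum_a \sum_b S c d a * H a b * J e b.
pose T c d e := \sum_a \sum_b J d a * (\sum_p J c p * D p a b) * J e b.
have PT c d e :
    pullback_derivative J H D S c d e = P c d e + T c d e + P c e d.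
  rewrite /pullback_derivative /P /T [X in _ + X]exchange_big/= -!big_split/=.
  apply: eq_bigr => a _; rewrite -!big_split/=; apply: eq_bigr => b _.
  have -> : H a b = H b a by rewrite -[in LHS]HT mxE.
  by ring.
have Psym c d e : P c d e = P d c e.
  by apply: eq_bigr => a _; apply: eq_bigr => b _; rewrite Ssym.
have Pl : P i j l = \sum_a J l a * \sum_b H a b * S i j b.
  rewrite /P exchange_big/=; apply: eq_bigr => a _; rewrite big_distrr/=.
  apply: eq_bigr => b _.
  have -> : H b a = H a b by rewrite -[in LHS]HT mxE.
  by ring.
have T1 : T i l j = \sum_a J l a * \sum_p \sum_q J i p * J j q * D p a q.
  apply: eq_bigr => a _; rewrite exchange_big/= big_distrr/=.
  apply: eq_bigr => b _; rewrite mulrAC -mulrA; congr (_ * _).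
  by rewrite big_distrr/=; apply: eq_bigr => p _; ring.
have T2 : T j l i = \sum_a J l a * \sum_p \sum_q J i p * J j q * D q a p.
  apply: eq_bigr => a _; rewrite big_distrr/=.
  apply: eq_bigr => b _; rewrite mulrAC -mulrA; congr (_ * _).
  by rewrite big_distrr/=; apply: eq_bigr => p _; ring.
have T3 : T l i j = \sum_a J l a * \sum_p \sum_q J i p * J j q * D a p q.
  under [RHS]eq_bigr do rewrite big_distrr/=.
  rewrite [RHS]exchange_big/=; apply: eq_bigr => p _.
  under [RHS]eq_bigr do rewrite big_distrr/=.
  rewrite [RHS]exchange_big/=; apply: eq_bigr => q _.
  rewrite big_distrr/= big_distrl/=.
  by apply: eq_bigr => a _; ring.
rewrite !PT (Psym i l) (Psym j l) (Psym j i).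
transitivity (2 * P i j l + T i l j + T j l i - T l i j); first by ring.
rewrite Pl T1 T2 T3 big_distrr/= -!big_split/= -sumrB; apply: eq_bigr => a _.
transitivity (J l a * (2 * (\sum_b H a b * S i j b) +
    (\sum_p \sum_q J i p * J j q * D p a q
     + \sum_p \sum_q J i p * J j q * D q a p
     - \sum_p \sum_q J i p * J j q * D a p q))); first by ring.
congr (_ * (_ + _)); rewrite -big_split -sumrB/=; apply: eq_bigr => p _.
by rewrite -big_split -sumrB/=; apply: eq_bigr => q _; ring.
Qed.

(** Raising the index with [J^T (J H J^T)^-1 J = H^-1] frees [S] from the factor
    [J H] that it carries in the symbols of the first kind. *)
Lemma upper_christoffel_pullback J H D S (c i j : 'I_k) :
  H^T = H -> (forall c d a, S c d a = S d c a) ->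
  J \in unitmx -> H \in unitmx ->
  \sum_l upper_christoffel (J *m H *m J^T) (pullback_derivative J H D S) l i j
    * J l c =
  S i j c + \sum_a \sum_b upper_christoffel H D c a b * (J i a * J j b).
Proof.
move=> HT Ssym Ju Hu.
pose s : 'cV[F]_k := \col_b S i j b.
pose r : 'cV[F]_k := \col_a \sum_p \sum_q J i p * J j q * lower_christoffel D a p q.
pose G := J *m H *m J^T.
pose lo : 'cV[F]_k := \col_l lower_christoffel (pullback_derivative J H D S) l i j.
have loE : lo = J *m (2 *: (H *m s) + r).
  apply/matrixP => l o; rewrite !mxE lower_christoffel_pullback//.
  apply: eq_bigr => a _; rewrite !mxE; congr (_ * (2 * _ + _)).
  by apply: eq_bigr => b _; rewrite mxE.
transitivity ((2^-1 *: (J^T *m invmx G *m lo)) c 0).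
  rewrite -(mulmxA J^T (invmx G) lo) mxE mxE mulr_sumr; apply: eq_bigr => l _.
  rewrite !mxE /upper_christoffel -/G.
  under [in RHS]eq_bigr do rewrite mxE.
  by ring.
rewrite loE mulmxA invmx_pullback// mulmxDr -scalemxAr mulKmx//.
rewrite scalerDr scalerA mulVf ?pnatr_eq0// scale1r !mxE; congr (_ + _).
rewrite mulr_sumr.
under [RHS]eq_bigr do under eq_bigr do
  rewrite /upper_christoffel -mulrA mulr_suml mulr_sumr.
under [RHS]eq_bigr do rewrite exchange_big/=.
rewrite [RHS]exchange_big/=; apply: eq_bigr => l _; rewrite mxE !mulr_sumr.
apply: eq_bigr => p _; rewrite !mulr_sumr; apply: eq_bigr => q _.
by ring.
Qed.

End ChristoffelAlgebra.

(** * Christoffel symbols of a pulled-back metric *)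

Section ChristoffelPullback.
Context {R : realType} {k : nat}.
Implicit Types (A B : set 'rV[R]_k) (Phi : 'rV[R]_k -> 'rV[R]_k).
Implicit Types (g h : 'rV[R]_k -> 'M[R]_k) (u : 'rV[R]_k).

Definition partials A h u (c a b : 'I_k) : R := pderiv A c (fun y => h y a b) u.

Definition hessian A Phi u (c d a : 'I_k) : R :=
  pderiv A c (pderiv A d (fun y => Phi y 0 a)) u.

Lemma christoffel_upper A h u (c i j : 'I_k) :
  christoffel A h u c i j = upper_christoffel (h u) (partials A h u) c i j.
Proof. by []. Qed.

Lemma jacobianE (l : nat) A (f : 'rV[R]_k -> 'rV[R]_l) u i j :
  rel_open A -> A u -> diff_within A f u ->
  jacobian A f u i j = pderiv A i (fun y => f y 0 j) u.
Proof. by move=> Ao Au df; rewrite mxE pderiv_coord. Qed.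

Lemma partials_pullback A B Phi g h u (c l j : 'I_k) :
  rel_open A -> rel_open B -> smooth_on A Phi -> (forall b, A b -> B (Phi b)) ->
  A u ->
  (forall b, A b ->
    g b = jacobian A Phi b *m h (Phi b) *m (jacobian A Phi b)^T) ->
  (forall a b, diff_within B (fun y => h y a b) (Phi u)) ->
  partials A g u c l j =
  pullback_derivative (jacobian A Phi u) (h (Phi u)) (partials B h (Phi u))
    (hessian A Phi u) c l j.
Proof.
move=> Ao Bo sPhi AB Au gE dh.
have dPhi b : A b -> diff_within A Phi b by exact: smooth_on_diff_within.
have JE b i a : A b -> jacobian A Phi b i a = pderiv A i (fun y => Phi y 0 a) b.
  by move=> Ab; rewrite jacobianE//; exact: dPhi.
have dJ i a : diff_within A (pderiv A i (fun y => Phi y 0 a)) u.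
  exact: pderiv_diff_within.
have dhP a b : diff_within A (fun y => h (Phi y) a b) u.
  apply: (diff_within_comp Au _ (dPhi _ Au) (dh a b)).
  exact: near_everywhere.
have dJh i a b : diff_within A
    (fun y => pderiv A i (fun y => Phi y 0 a) y * h (Phi y) a b) u.
  exact: diff_withinM.
have dterm a b : diff_within A
    (fun y => pderiv A l (fun y => Phi y 0 a) y * h (Phi y) a b
              * pderiv A j (fun y => Phi y 0 b) y) u.
  exact: diff_withinM.
rewrite /partials (pderiv_local (B := A) (f := fun y => \sum_a \sum_b
  pderiv A l (fun y => Phi y 0 a) y * h (Phi y) a b
    * pderiv A j (fun y => Phi y 0 b) y))//; last 2 first.
- apply: near_everywhere => b Ab; split=> //.
  rewrite gE// mxE exchange_big/=; apply: eq_bigr => q _.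
  by rewrite mxE mulr_suml; apply: eq_bigr => p _; rewrite !mxE -!JE// !mxE.
- by apply: diff_within_sum => a; apply: diff_within_sum.
rewrite pderiv_sum//; last by move=> a; exact: diff_within_sum.
apply: eq_bigr => a _; rewrite pderiv_sum//; apply: eq_bigr => b _.
rewrite pderivM// pderivM// (pderiv_comp (B := B) (f := fun y => h y a b))//; last first.
  exact: dPhi.
rewrite !JE// /hessian.
have -> : \sum_e (pderiv A c Phi u) 0 e *: pderiv B e (fun y => h y a b) (Phi u)
  = \sum_e jacobian A Phi u c e * pderiv B e (fun y => h y a b) (Phi u).
  by apply: eq_bigr => e _; rewrite mxE.
have product_rule (x y z dx dy dz : R) :
    x * y * dz + z * (x * dy + y * dx) = dx * y * z + x * dy * z + x * y * dz.
  by ring.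
exact: product_rule.
Qed.

(** The inhomogeneous transformation law of the Christoffel symbols. *)
Lemma christoffel_pullback A B Phi g h u (c i j : 'I_k) :
  rel_open A -> rel_open B -> smooth_on A Phi -> (forall b, A b -> B (Phi b)) ->
  A u ->
  (forall b, A b ->
    g b = jacobian A Phi b *m h (Phi b) *m (jacobian A Phi b)^T) ->
  (forall a b, diff_within B (fun y => h y a b) (Phi u)) ->
  (h (Phi u))^T = h (Phi u) -> h (Phi u) \in unitmx ->
  jacobian A Phi u \in unitmx ->
  \sum_l christoffel A g u l i j * jacobian A Phi u l c =
  hessian A Phi u i j c
  + \sum_a \sum_b christoffel B h (Phi u) c a b
      * (jacobian A Phi u i a * jacobian A Phi u j b).
Proof.
move=> Ao Bo sPhi AB Au gE dh hT hu Ju.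
have Hsym c' d a : hessian A Phi u c' d a = hessian A Phi u d c' a.
  exact: pderiv_sym.
rewrite -(upper_christoffel_pullback (partials B h (Phi u)) _ _ _ hT Hsym)//.
apply: eq_bigr => l _; rewrite christoffel_upper gE//; congr (_ * _ * _).
apply: eq_bigr => m _; congr (_ * _).
by rewrite /lower_christoffel !(partials_pullback _ _ _ Ao Bo sPhi AB Au gE dh).
Qed.

End ChristoffelPullback.

(** * Jacobians and local expressions of maps *)

Section Jacobians.
Context {R : realType}.

Lemma jacobian_comp (k l n : nat) (A : set 'rV[R]_k) (B : set 'rV[R]_l)
    (g : 'rV[R]_k -> 'rV[R]_l) (f : 'rV[R]_l -> 'rV[R]_n) (a : 'rV[R]_k) :
  rel_open A -> rel_open B -> A a -> (forall b, A b -> B (g b)) ->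
  diff_within A g a -> diff_within B f (g a) ->
  jacobian A (f \o g) a = jacobian A g a *m jacobian B f (g a).
Proof.
move=> Ao Bo Aa AB dg df; apply/matrixP => i j; rewrite !mxE.
rewrite (pderiv_comp _ Ao Bo)// summxE; apply: eq_bigr => e _.
by rewrite !mxE.
Qed.

Lemma jacobian_local (k l : nat) (A B : set 'rV[R]_k)
    (f g : 'rV[R]_k -> 'rV[R]_l) (a : 'rV[R]_k) :
  rel_open A -> rel_open B -> A a -> B a ->
  (\forall b \near a, A b -> B b /\ f b = g b) ->
  diff_within B f a -> jacobian A g a = jacobian B f a.
Proof.
move=> Ao Bo Aa Ba AB df; apply/matrixP => i j; rewrite !mxE.
by rewrite (pderiv_local i Ao Bo Aa Ba AB df).
Qed.

Lemma jacobian_id (k : nat) (A : set 'rV[R]_k) (a : 'rV[R]_k) :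
  rel_open A -> A a -> jacobian A id a = 1%:M.
Proof.
move=> Ao Aa; apply/matrixP => i j; rewrite !mxE.
rewrite (pderiv_ext (F := id) i Ao Aa)//; last exact: near_everywhere.
by rewrite diff_val mxE eqxx eq_sym.
Qed.

Lemma diff_within_id (V : normedModType R) (A : set V) (a : V) :
  diff_within A id a.
Proof. by exists id => //; exact: near_everywhere. Qed.

Lemma gram_unitmx (k n : nat) (J : 'M[R]_(k, n)) :
  row_free J -> J *m J^T \in unitmx.
Proof.
move=> Jfree; rewrite -row_free_unit; apply: inj_row_free => a aG.
apply: (row_free_inj Jfree); rewrite mul0mx; apply/rowP => j; rewrite [RHS]mxE.
have : ((a *m J) *m (a *m J)^T) 0 0 = 0.
  by rewrite trmx_mul mulmxA -(mulmxA a) aG mul0mx mxE.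
rewrite mxE => aJ0.
have sq i : 0 <= (a *m J) 0 i * (a *m J)^T i 0.
  by rewrite [X in _ * X]mxE -expr2 sqr_ge0.
have /eqP := psumr_eq0P (fun i _ => sq i) aJ0 (i := j) isT.
by rewrite [X in _ * X]mxE mulf_eq0 orbb => /eqP.
Qed.

Lemma posdef_unitmx (k : nat) (H : 'M[R]_k) :
  (forall a : 'rV[R]_k, a != 0 -> 0 < (a *m H *m a^T) 0 0) -> H \in unitmx.
Proof.
move=> Hpos; rewrite -row_free_unit; apply: inj_row_free => a aH.
by apply/eqP; apply: contraT => /Hpos; rewrite aH mul0mx mxE ltxx.
Qed.

End Jacobians.

Section LocalRepresentations.
Context {R : realType} {k : nat}.
Implicit Types (M N : manifold R k).

(** For the identity map this is the overlap of the two charts, and [chart_rep]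
    is the transition map. *)
Definition chart_dom (M N : manifold R k) (f : M -> N) (C1 : chart R k M)
    (C2 : chart R k N) : set 'rV[R]_k :=
  [set u | cimg C1 u /\ cdom C2 (f (cinv C1 u))].

Definition chart_rep (M N : manifold R k) (f : M -> N) (C1 : chart R k M)
    (C2 : chart R k N) : 'rV[R]_k -> 'rV[R]_k :=
  cmap C2 \o f \o cinv C1.

Lemma cmapK M (C : chart R k M) (p : M) :
  atlas M C -> cdom C p -> cinv C (cmap C p) = p.
Proof. by move=> /atlas_chart[_ _ CK _ _]; exact: CK. Qed.

Lemma cimg_cmap M (C : chart R k M) (p : M) : cdom C p -> cimg C (cmap C p).
Proof. by exists p. Qed.

Lemma cimgP M (C : chart R k M) u : atlas M C -> cimg C u ->
  cdom C (cinv C u) /\ cmap C (cinv C u) = u.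
Proof. by move=> aC [p Cp <-]; rewrite cmapK. Qed.

Lemma cimg_rel_open M (C : chart R k M) : atlas M C -> rel_open (cimg C).
Proof.
move=> /atlas_chart[_ [U oU CE] _ _ _]; rewrite CE; split; first by move=> ? [].
move=> a [Ua _]; have := open_nbhs_nbhs (conj oU Ua).
by apply: filterS => b Ub Hb.
Qed.

Lemma cinv_near M (C : chart R k M) (u : 'rV[R]_k) (P : set M) :
  atlas M C -> cimg C u -> nbhs (cinv C u) P ->
  \forall b \near u, cimg C b -> P (cinv C b).
Proof.
move=> /atlas_chart[_ _ _ _ /subspace_continuousP cC] Cu Pu.
by have := cC u Cu _ Pu.
Qed.

Lemma cmap_cvg M (C : chart R k M) (p : M) :
  atlas M C -> cdom C p -> cmap C q @[q --> p] --> cmap C p.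
Proof.
move=> /atlas_chart[oC _ _ + _] Cp.
by rewrite continuous_open_subspace// => /(_ p); apply; rewrite inE.
Qed.

Lemma cdom_nbhs M (C : chart R k M) (p : M) :
  atlas M C -> cdom C p -> nbhs p (cdom C).
Proof. by move=> /atlas_chart[oC _ _ _ _] Cp; exact: open_nbhs_nbhs. Qed.

Lemma chart_dom_near M N (f : M -> N) C1 C2 u :
  atlas M C1 -> atlas N C2 -> continuous f -> chart_dom f C1 C2 u ->
  \forall b \near u, cimg C1 b -> chart_dom f C1 C2 b.
Proof.
move=> a1 a2 cf [Cu fu].
have := cinv_near a1 Cu (cf _ _ (cdom_nbhs a2 fu)).
by apply: filterS => b Hb Cb; split=> //; exact: Hb.
Qed.

Lemma chart_dom_rel_open M N (f : M -> N) C1 C2 :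
  atlas M C1 -> atlas N C2 -> continuous f -> rel_open (chart_dom f C1 C2).
Proof.
move=> a1 a2 cf; have [CH Co] := cimg_rel_open a1; split.
  by move=> u [/CH].
move=> u Au; have [Cu _] := Au.
apply: filterS2 (Co _ Cu) (chart_dom_near a1 a2 cf Au) => b Hb Ab hb.
exact: (Ab (Hb hb)).
Qed.

Lemma chart_rep_cimg M N (f : M -> N) C1 C2 u :
  chart_dom f C1 C2 u -> cimg C2 (chart_rep f C1 C2 u).
Proof. by move=> [_ fu]; exists (f (cinv C1 u)). Qed.

Lemma chart_dom_cmap M N (f : M -> N) C1 C2 p :
  atlas M C1 -> cdom C1 p -> cdom C2 (f p) -> chart_dom f C1 C2 (cmap C1 p).
Proof. by move=> a1 Cp fp; split; [exact: cimg_cmap|rewrite cmapK]. Qed.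

Lemma chart_rep_cmap M N (f : M -> N) C1 C2 p :
  atlas M C1 -> cdom C1 p -> chart_rep f C1 C2 (cmap C1 p) = cmap C2 (f p).
Proof. by move=> a1 Cp; rewrite /chart_rep/= cmapK. Qed.

(** The chain rule applied to the local expressions of [g \o f = id]. *)
Lemma chart_rep_jacobian_inv M N (f : M -> N) (g : N -> M) C1 C2 u :
  diffeomorphism f g -> atlas M C1 -> atlas N C2 -> chart_dom f C1 C2 u ->
  jacobian (chart_dom f C1 C2) (chart_rep f C1 C2) u *m
  jacobian (chart_dom g C2 C1) (chart_rep g C2 C1) (chart_rep f C1 C2 u) = 1%:M.
Proof.
move=> [[cf sf] [cg sg] fK gK] a1 a2 Au.
have Ao := chart_dom_rel_open a1 a2 cf.
have Bo := chart_dom_rel_open a2 a1 cg.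
have AB b : chart_dom f C1 C2 b -> chart_dom g C2 C1 (chart_rep f C1 C2 b).
  move=> [Cb fb]; split; first exact: cimg_cmap.
  by rewrite /chart_rep/= cmapK// fK; have [] := cimgP a1 Cb.
have gfK b : chart_dom f C1 C2 b ->
    chart_rep g C2 C1 (chart_rep f C1 C2 b) = b.
  move=> [Cb fb]; rewrite /chart_rep/= cmapK// fK.
  by have [] := cimgP a1 Cb.
rewrite -jacobian_comp//; last 2 first.
- by apply: smooth_on_diff_within => //; exact: sf.
- by apply: smooth_on_diff_within; [exact: sg|exact: AB].
rewrite (jacobian_local (B := chart_dom f C1 C2) (f := id))//.
- exact: jacobian_id.
- by apply: near_everywhere => b Ab; split=> //=; rewrite gfK.
- exact: diff_within_id.
Qed.

Lemma chart_rep_jacobian_unitmx M N (f : M -> N) (g : N -> M) C1 C2 u :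
  diffeomorphism f g -> atlas M C1 -> atlas N C2 -> chart_dom f C1 C2 u ->
  jacobian (chart_dom f C1 C2) (chart_rep f C1 C2) u \in unitmx.
Proof. by move=> fg a1 a2 /(chart_rep_jacobian_inv fg a1 a2)/mulmx1_unit[]. Qed.

Lemma diffeomorphism_sym M N (f : M -> N) (g : N -> M) :
  diffeomorphism f g -> diffeomorphism g f.
Proof. by move=> []. Qed.

Lemma diffeomorphism_id M : diffeomorphism (@id M) id.
Proof.
have : smooth_map (@id M).
  split=> [p|C1 C2 a1 a2]; first exact: cvg_id.
  have [+ _] := atlas_compatible a1 a2.
  apply: smooth_onW => u [Cu C2u]; split=> //.
  by have [C1u uE] := cimgP a1 Cu; exists (cinv C1 u).
by move=> ?; split.
Qed.

Lemma overlapE M C1 C2 : atlas M C1 -> overlap C1 C2 = chart_dom (@id M) C1 C2.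
Proof.
move=> a1; apply/seteqP; split=> u.
  by move=> [p [C1p C2p] <-]; exact: chart_dom_cmap.
by move=> [Cu C2u]; have [C1u uE] := cimgP a1 Cu; exists (cinv C1 u).
Qed.

End LocalRepresentations.

(** * Map Laplacian and DeTurck field *)

Section Metrics.
Context {R : realType} {k : nat}.
Implicit Types (M N : manifold R k).

(** The properties of a metric on which the Christoffel calculus rests;
    positivity enters only through nondegeneracy. *)
Definition regular_metric M (h : cotensor2 M) : Prop :=
  forall C u, atlas M C -> cimg C u ->
    [/\ forall a b, diff_within (cimg C) (fun y => h C y a b) u,
        (h C u)^T = h C u & h C u \in unitmx].

Definition is_pullback M N (f : M -> N) (g : cotensor2 M) (h : cotensor2 N) :=
  forall C1 C2 u, atlas M C1 -> atlas N C2 -> chart_dom f C1 C2 u ->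
    let J := jacobian (chart_dom f C1 C2) (chart_rep f C1 C2) u in
    g C1 u = J *m h C2 (chart_rep f C1 C2 u) *m J^T.

(** Enough regularity for the induced metric to be once differentiable. Stated
    with [diff_within], it passes to compositions with a diffeomorphism by the
    chain rule alone. *)
Definition regular_immersion n M (y : M -> 'rV[R]_n) : Prop :=
  forall C u, atlas M C -> cimg C u ->
    [/\ diff_within (cimg C) (y \o cinv C) u,
        forall i l, diff_within (cimg C)
          (pderiv (cimg C) i (fun v => y (cinv C v) 0 l)) u &
        row_free (jacobian (cimg C) (y \o cinv C) u)].

Lemma riemannian_regular M (h : cotensor2 M) :
  riemannian_metric h -> regular_metric h.
Proof.
move=> [hs hT hpos _] C u aC Cu; split.
- by move=> a b; apply: diff_within_coord; exact: smooth_on_diff_within (hs C aC) Cu.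
- exact: hT.
- by apply: posdef_unitmx => a; exact: hpos.
Qed.

Lemma riemannian_pullback_id M (h : cotensor2 M) :
  riemannian_metric h -> is_pullback (@id M) h h.
Proof.
move=> [_ _ _ hch] C1 C2 u a1 a2 Au J; rewrite /J -overlapE//.
have [Cu C2u] := Au; have [C1u uE] := cimgP a1 Cu.
by have := hch C1 C2 (cinv C1 u) a1 a2 C1u C2u; rewrite uE.
Qed.

Lemma embedding_immersion n M (y : M -> 'rV[R]_n) :
  smooth_embedding y -> regular_immersion y.
Proof.
move=> [ys yfree _ _ _] C u aC Cu; split.
- exact: smooth_on_diff_within (ys C aC) Cu.
- move=> i l; exact: (pderiv_diff_within i (cimg_rel_open aC) (ys C aC) Cu 0 l).
- exact: yfree.
Qed.

Lemma pullback_euclideanE n M (y : M -> 'rV[R]_n) C u :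
  pullback_euclidean y C u =
  jacobian (cimg C) (y \o cinv C) u *m (jacobian (cimg C) (y \o cinv C) u)^T.
Proof.
by apply/matrixP => i j; rewrite !mxE; apply: eq_bigr => l _; rewrite !mxE.
Qed.

Lemma immersion_regular n M (y : M -> 'rV[R]_n) :
  regular_immersion y -> regular_metric (pullback_euclidean y).
Proof.
move=> yi C u aC Cu; have [dy d2y yfree] := yi C u aC Cu; split.
- move=> a b; apply: (diff_within_local (B := cimg C) (f := fun v =>
    \sum_(l < n) pderiv (cimg C) a (fun v => y (cinv C v) 0 l) v *
      pderiv (cimg C) b (fun v => y (cinv C v) 0 l) v)).
    apply: near_everywhere => v Cv; split=> //; rewrite mxE.
    have [dyv _ _] := yi C v aC Cv.
    apply: eq_bigr => l _.
    by rewrite -!(pderiv_coord _ 0 l (cimg_rel_open aC) Cv dyv).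
  by apply: diff_within_sum => l; exact: diff_withinM.
- by rewrite pullback_euclideanE trmx_mul trmxK.
- by rewrite pullback_euclideanE gram_unitmx.
Qed.

Section Diffeomorphism.
Variables (M N : manifold R k) (f : M -> N) (finv : N -> M).
Hypothesis fdiffeo : diffeomorphism f finv.

Let cf : continuous f. Proof. by case: fdiffeo => [[]]. Qed.

Lemma chart_rep_smooth C1 C2 : atlas M C1 -> atlas N C2 ->
  smooth_on (chart_dom f C1 C2) (chart_rep f C1 C2).
Proof. by case: fdiffeo => [[_ sf] _ _ _]; exact: sf. Qed.

Section Charts.
Variables (C1 : chart R k M) (C2 : chart R k N).
Hypotheses (a1 : atlas M C1) (a2 : atlas N C2).
Local Notation A := (chart_dom f C1 C2).
Local Notation Phi := (chart_rep f C1 C2).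

Let Ao : rel_open A. Proof. exact: chart_dom_rel_open. Qed.
Let Co : rel_open (cimg C1). Proof. exact: cimg_rel_open. Qed.
Let Bo : rel_open (cimg C2). Proof. exact: cimg_rel_open. Qed.

Lemma chart_rep_diff u : A u -> diff_within A Phi u.
Proof. exact: smooth_on_diff_within (chart_rep_smooth a1 a2). Qed.

Lemma chart_comp_near n (y : N -> 'rV[R]_n) u : A u ->
  \forall b \near u, cimg C1 b ->
    A b /\ ((y \o cinv C2) \o Phi) b = ((y \o f) \o cinv C1) b.
Proof.
move=> Au; apply: filterS (chart_dom_near a1 a2 cf Au) => b Ab Cb.
by have [_ fb] := Ab Cb; split; [exact: Ab|rewrite /chart_rep/= cmapK].
Qed.

Lemma diff_chart_comp n (y : N -> 'rV[R]_n) u : A u ->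
  diff_within (cimg C2) (y \o cinv C2) (Phi u) ->
  diff_within A ((y \o cinv C2) \o Phi) u.
Proof.
move=> Au dy; apply: (diff_within_comp Au _ (chart_rep_diff Au) dy).
by apply: near_everywhere => b; exact: chart_rep_cimg.
Qed.

Lemma diff_comp_chart n (y : N -> 'rV[R]_n) u : A u ->
  diff_within (cimg C2) (y \o cinv C2) (Phi u) ->
  diff_within (cimg C1) ((y \o f) \o cinv C1) u.
Proof.
move=> Au dy; apply: diff_within_local (diff_chart_comp Au dy).
exact: chart_comp_near.
Qed.

Lemma jacobian_chart_comp n (y : N -> 'rV[R]_n) u : A u ->
  diff_within (cimg C2) (y \o cinv C2) (Phi u) ->
  jacobian (cimg C1) ((y \o f) \o cinv C1) u =
  jacobian A Phi u *m jacobian (cimg C2) (y \o cinv C2) (Phi u).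
Proof.
move=> Au dy; have [Cu _] := Au.
rewrite (jacobian_local Co Ao Cu Au (chart_comp_near y Au)); last first.
  exact: diff_chart_comp.
apply: jacobian_comp => //; first by move=> b; exact: chart_rep_cimg.
exact: chart_rep_diff.
Qed.

End Charts.

(** Near a point the first derivatives of [y \o f] are, by the chain rule, sums of
    products of functions that are differentiable again. *)
Lemma immersion_comp n (y : N -> 'rV[R]_n) :
  regular_immersion y -> regular_immersion (y \o f).
Proof.
move=> yi C1 u a1 Cu.
have [C2 a2 fu] := atlas_cover (f (cinv C1 u)).
have Au : chart_dom f C1 C2 u by [].
have yP v (Av : chart_dom f C1 C2 v) := yi C2 _ a2 (chart_rep_cimg Av).
have [dy d2y yfree] := yP u Au.
have Ao := chart_dom_rel_open a1 a2 cf.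
have Co := cimg_rel_open a1; have Bo := cimg_rel_open a2.
split; first exact: diff_comp_chart dy.
- move=> i l; apply: (diff_within_local (B := chart_dom f C1 C2) (f := fun v =>
    \sum_(j < k) pderiv (chart_dom f C1 C2) i
        (fun w => chart_rep f C1 C2 w 0 j) v *
      (pderiv (cimg C2) j (fun w => y (cinv C2 w) 0 l) \o chart_rep f C1 C2) v)).
    apply: filterS (chart_dom_near a1 a2 cf Au) => v Av Cv.
    have {}Av := Av Cv; split=> //; have [dyv _ _] := yP v Av.
    rewrite (pderiv_coord i 0 l Co Cv (diff_comp_chart a1 a2 Av dyv)).
    have := jacobian_chart_comp a1 a2 Av dyv => /matrixP/(_ i l).
    rewrite [LHS]mxE => ->; rewrite mxE; apply: eq_bigr => j _.
    rewrite (jacobianE _ _ Ao Av (chart_rep_diff a1 a2 Av)); congr (_ * _).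
    by rewrite (jacobianE _ _ Bo (chart_rep_cimg Av) dyv).
  apply: diff_within_sum => j; apply: diff_withinM.
    exact: pderiv_diff_within (chart_rep_smooth a1 a2) _ _ _.
  apply: (diff_within_comp Au _ (chart_rep_diff a1 a2 Au) (d2y j l)).
  by apply: near_everywhere => b; exact: chart_rep_cimg.
- rewrite (jacobian_chart_comp a1 a2 Au dy) /row_free.
  by rewrite eqmxMfull// row_full_unit (chart_rep_jacobian_unitmx fdiffeo).
Qed.

Lemma pullback_euclidean_comp n (y : N -> 'rV[R]_n) :
  regular_immersion y ->
  is_pullback f (pullback_euclidean (y \o f)) (pullback_euclidean y).
Proof.
move=> yi C1 C2 u a1 a2 Au J.
have [dy _ _] := yi C2 _ a2 (chart_rep_cimg Au).
rewrite !pullback_euclideanE (jacobian_chart_comp a1 a2 Au dy) trmx_mul.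
by rewrite !mulmxA.
Qed.

Section Laplacian.
Variables (g : cotensor2 M) (h : cotensor2 N).
Hypotheses (greg : regular_metric g) (hreg : regular_metric h).
Hypothesis gh : is_pullback f g h.
Variables (C1 : chart R k M) (C2 : chart R k N) (p : M).
Hypotheses (a1 : atlas M C1) (a2 : atlas N C2) (C1p : cdom C1 p).
Hypothesis C2fp : cdom C2 (f p).
Local Notation A := (chart_dom f C1 C2).
Local Notation Phi := (chart_rep f C1 C2).
Local Notation u := (cmap C1 p).
Local Notation J := (jacobian A Phi u).

Let Au : A u. Proof. exact: chart_dom_cmap. Qed.
Let PhiE : Phi u = cmap C2 (f p). Proof. exact: chart_rep_cmap. Qed.

(** [christoffel_pullback] on a manifold. The metric is differentiated on all of
    [cimg C1] in the statement and on the domain of the local expression of [f] in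
    the proof; both derivatives agree because the second domain is relatively open
    in the first. *)
Lemma christoffel_diffeo (c i j : 'I_k) :
  \sum_l christoffel (cimg C1) (g C1) u l i j * J l c =
  hessian A Phi u i j c
  + \sum_a \sum_b christoffel (cimg C2) (h C2) (cmap C2 (f p)) c a b
      * (J i a * J j b).
Proof.
have Ao := chart_dom_rel_open a1 a2 cf.
have [hd hT hu] := hreg a2 (cimg_cmap C2fp).
have [gd _ _] := greg a1 (cimg_cmap C1p).
rewrite -PhiE in hd hT hu *.
rewrite -(@christoffel_pullback _ _ _ (cimg C2) _ (g C1)) //; last 5 first.
- exact: cimg_rel_open.
- exact: chart_rep_smooth.
- by move=> b; exact: chart_rep_cimg.
- by move=> b Ab; exact: gh.
- exact: chart_rep_jacobian_unitmx fdiffeo a1 a2 Au.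
apply: eq_bigr => l _; congr (_ * _); rewrite !christoffel_upper.
have E c' a b : partials (cimg C1) (g C1) u c' a b = partials A (g C1) u c' a b.
  rewrite /partials; apply/esym; apply: pderiv_local => //.
  - exact: cimg_rel_open.
  - by case: Au.
  - by apply: near_everywhere => v [].
rewrite /upper_christoffel; congr (_ * _); apply: eq_bigr => m _.
by rewrite /lower_christoffel !E.
Qed.

Lemma invmx_diffeo (a b : 'I_k) :
  \sum_i \sum_j invmx (g C1 u) i j * (J i a * J j b) =
  invmx (h C2 (cmap C2 (f p))) a b.
Proof.
have [_ _ hu] := hreg a2 (cimg_cmap C2fp).
have Ju : J \in unitmx by exact: chart_rep_jacobian_unitmx fdiffeo a1 a2 Au.
rewrite -(invmx_pullback Ju hu) -PhiE -gh// [RHS]mxE exchange_big/=.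
apply: eq_bigr => j _; rewrite [X in _ = X * _]mxE mulr_suml.
apply: eq_bigr => i _; rewrite [X in _ = X * _ * _]mxE.
by rewrite mulrA [X in X * _]mulrC.
Qed.

(** The Jacobian matrices are absorbed by [invmx_diffeo]. *)
Lemma trace_diffeo (K : 'I_k -> 'I_k -> R) :
  \sum_i \sum_j invmx (g C1 u) i j * (\sum_a \sum_b K a b * (J i a * J j b)) =
  \sum_a \sum_b invmx (h C2 (cmap C2 (f p))) a b * K a b.
Proof.
under eq_bigr do under eq_bigr do rewrite mulr_sumr.
under eq_bigr do rewrite exchange_big/=.
rewrite exchange_big/=; apply: eq_bigr => a _.
under eq_bigr do under eq_bigr do rewrite mulr_sumr.
under eq_bigr do rewrite exchange_big/=.
rewrite exchange_big/=; apply: eq_bigr => b _.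
rewrite -invmx_diffeo mulr_suml; apply: eq_bigr => i _.
by rewrite mulr_suml; apply: eq_bigr => j _; ring.
Qed.

End Laplacian.

Section Conclusions.
Variables (g : cotensor2 M) (h m : cotensor2 N).
Hypotheses (greg : regular_metric g) (hreg : regular_metric h).
Hypothesis gh : is_pullback f g h.
Variables (C1 : chart R k M) (C2 : chart R k N) (p : M).
Hypotheses (a1 : atlas M C1) (a2 : atlas N C2) (C1p : cdom C1 p).
Hypothesis C2fp : cdom C2 (f p).

(** The second derivatives of [f] cancel against those in the transformation law of
    [Gamma(g)]; only the difference of two Christoffel symbols of the target
    remains, traced with the metric of the target. *)
Lemma map_laplacian_deturck :
  map_laplacian g m f C1 C2 p = deturck_field h m C2 (f p).
Proof.
apply/rowP => c; rewrite !mxE -(trace_diffeo hreg gh a1 a2 C1p C2fp).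
have Ao := chart_dom_rel_open a1 a2 cf.
have Au : chart_dom f C1 C2 (cmap C1 p) by exact: chart_dom_cmap.
apply: eq_bigr => i _; apply: eq_bigr => j _; congr (_ * _).
have JE i' a' : pderiv (chart_dom f C1 C2) i'
    (fun u => cmap C2 (f (cinv C1 u)) 0 a') (cmap C1 p) =
    jacobian (chart_dom f C1 C2) (chart_rep f C1 C2) (cmap C1 p) i' a'.
  by rewrite (jacobianE _ _ Ao Au (chart_rep_diff a1 a2 Au)).
under [X in _ - X + _]eq_bigr do rewrite JE.
rewrite (christoffel_diffeo greg hreg gh a1 a2 C1p C2fp).
under [X in _ + X = _]eq_bigr do under eq_bigr do rewrite !JE.
rewrite opprD addrA subrr add0r addrC -sumrB; apply: eq_bigr => a _.
by rewrite -sumrB; apply: eq_bigr => b _; ring.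
Qed.

End Conclusions.

End Diffeomorphism.

(** The second derivatives of the transition map are the same for both metrics, so
    the difference of their Christoffel symbols is a tensor. *)
Lemma deturck_tangent M (g m : cotensor2 M) :
  regular_metric g -> regular_metric m ->
  is_pullback (@id M) g g -> is_pullback (@id M) m m ->
  tangent_field (deturck_field g m).
Proof.
move=> greg mreg gg mm C1 C2 p a1 a2 C1p C2p.
have idd := diffeomorphism_id M.
rewrite overlapE//; apply/rowP => c; rewrite /deturck_field mxE [RHS]mxE.
rewrite -(trace_diffeo idd greg gg a1 a2 C1p C2p).
under [RHS]eq_bigr => l _ do rewrite [X in X * _]mxE mulr_suml.
rewrite [RHS]exchange_big/=; apply: eq_bigr => i _.
under [RHS]eq_bigr => l _ do rewrite mulr_suml.
rewrite [RHS]exchange_big/=; apply: eq_bigr => j _.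
under [RHS]eq_bigr => l _ do rewrite -mulrA mulrBl.
rewrite -mulr_sumr sumrB; congr (_ * _).
rewrite (christoffel_diffeo idd greg greg gg a1 a2 C1p C2p).
rewrite (christoffel_diffeo idd mreg mreg mm a1 a2 C1p C2p).
rewrite opprD addrACA subrr add0r -sumrB; apply: eq_bigr => a _.
by rewrite -sumrB; apply: eq_bigr => b _; ring.
Qed.

End Metrics.

(** * Differentiating an implicitly defined curve *)

Section ImplicitDerivative.
Context {R : realType}.

(** Outside a neighbourhood [V] of [g t p] no point is sent to [p] at time [t]; by
    compactness of the complement of [V] this persists for nearby times, so that
    [g s p] lies in [V]. *)
Lemma inverse_family_cvg (X Y : topologicalType) (I : set R)
    (f : R -> X -> Y) (g : R -> Y -> X) (t : R) (p : Y) :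
  compact [set: X] -> hausdorff_space Y -> nbhs t I ->
  {within [set z : X * R | I z.2], continuous (fun z : X * R => f z.2 z.1)} ->
  (forall s, I s -> cancel (f s) (g s) /\ cancel (g s) (f s)) ->
  g s p @[s --> t] --> g t p.
Proof.
move=> Xcpt YH It /subspace_continuousP cf fg U.
rewrite nbhsE => -[V [oV Vg] VU].
have cptK : compact (~` V).
  apply: subclosed_compact Xcpt _ => //; exact: open_closedC.
have K : \forall s \near t, ~` V `<=` (fun y => I s -> f s y <> p).
  have := (compact_near_coveringP (~` V)).1 cptK R (nbhs t)
    (fun s y => I s -> f s y <> p) _.
  apply => y Vy.
  have fty : f t y <> p.
    move=> ftp; apply: Vy; have [ftK _] := fg t (nbhs_singleton It).
    by rewrite -(ftK y) ftp.
  have np : nbhs (f t y) (~` [set p]).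
    apply: open_nbhs_nbhs; split=> //; apply: closed_openC.
    exact/accessible_closed_set1/hausdorff_accessible.
  have := cf (y, t) (nbhs_singleton It) _ np.
  rewrite /= nbhs_simpl/= => H.
  by apply: filterS H => -[y' s] /= H Is; exact: H.
apply: filterS2 K It => s Ks Is; apply: VU.
apply: contrapT => /Ks /(_ Is); apply.
by have [_ ->] := fg s Is.
Qed.

Lemma is_diff_fst_slice (V W : normedModType R) (F : V * R -> W) (a : V) (t : R) :
  differentiable F (a, t) ->
  is_diff a (fun b => F (b, t)) (fun h => 'd F (a, t) (h, 0)).
Proof.
move=> dF.
have dp : is_diff a (fun b : V => (b, t)) (fun h => (h, 0)).
  exact: (@is_diff_pair _ _ _ _ id id (cst t) 0).
exact: (@is_diff_comp _ _ _ _ _ _ F ('d F (a, t)) a dp (differentiableP dF)).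
Qed.

Lemma is_diff_curve (V W : normedModType R) (F : V * R -> W) (u : R -> V)
    (du : V) (t : R) :
  differentiable F (u t, t) -> is_derive t 1 u du ->
  is_derive t 1 (fun s => F (u s, s)) ('d F (u t, t) (du, 1)).
Proof.
move=> dF [du1 duE].
have du' : differentiable u t by exact/derivable1_diffP.
have dp : is_diff t (fun s => (u s, s)) (fun h => ('d u t h, h)).
  exact: (@is_diff_pair _ _ _ _ u ('d u t) id id _ (differentiableP du')).
have dc := @is_diff_comp _ _ _ _ _ _ F ('d F (u t, t)) t dp (differentiableP dF).
have dF' : differentiable (fun s => F (u s, s)) t := @ex_diff _ _ _ _ _ _ _ dc.
apply: DeriveDef; first exact: diff_derivable.
rewrite deriveE//.
have -> : ('d (fun s => F (u s, s)) t : R -> W) = _ := @diff_val _ _ _ _ _ _ _ dc.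
by rewrite /= -(deriveE _ du') duE.
Qed.

(** Expand the constant [F (u s, s)] to first order and apply the left inverse [L]
    of the differential in the first variable: with [l := L ('d F (0, 1))], the
    vector [u s - u t + (s - t) l] is small compared to [|u s - u t| + |s - t|].
    The first of these two terms is then itself of order [|s - t|], because the
    curve is known to be continuous. *)
Lemma implicit_derivative (V W : normedModType R) (F : V * R -> W)
    (u : R -> V) (L : {linear W -> V}) (t : R) :
  continuous L -> differentiable F (u t, t) ->
  u s @[s --> t] --> u t ->
  (\forall s \near t, F (u s, s) = F (u t, t)) ->
  (forall h, L ('d F (u t, t) (h, 0)) = h) ->
  is_derive t 1 u (- L ('d F (u t, t) (0, 1))).
Proof.
move=> cL dF cu Fu LF; set l := L _.
suff H : (fun h : R => h^-1 *: (u (h *: 1 + t) - u t)) @ 0^' --> - l.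
  by apply: DeriveDef; [exact: cvgP H|exact: cvg_lim H].
have [C C0 LC] := linear_lipschitz cL.
apply/cvgrPdist_le => e e0.
(* The first bound on [c] makes [u] Lipschitz at [t], the second one turns the
   Lipschitz estimate into an error of size [e]. *)
pose c := Num.min (1 / 2) (e / (2 * `|l| + 2)).
have l2 : 0 < 2 * `|l| + 2 by rewrite ltr_wpDl// mulr_ge0.
have c0 : 0 < c by rewrite lt_min !divr_gt0.
have c1 : c <= 1 / 2 by rewrite ge_min lexx.
have c2 : c * (2 * `|l| + 2) <= e by rewrite -ler_pdivlMr// ge_min lexx orbT.
have ht : h + t @[h --> (0 : R)] --> t.
  rewrite -[X in _ --> X]add0r.
  by apply: cvgD; [exact: cvg_id|exact: cvg_cst].
have eta1 : (u (h + t) - u t) @[h --> (0 : R)] --> (0 : V).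
  rewrite -[X in _ --> X](subrr (u t)).
  by apply: cvgB; [exact: (cvg_comp _ _ ht cu)|exact: cvg_cst].
have eta0 : (u (h + t) - u t, h) @[h --> (0 : R)] --> (0 : V * R).
  exact: (cvg_pair eta1 cvg_id).
have HF : \forall h \near (0 : R), `|F ((u (h + t) - u t, h) + (u t, t))
    - F (u t, t) - 'd F (u t, t) (u (h + t) - u t, h)|
    <= c / C * `|(u (h + t) - u t, h)|.
  exact: eta0 (diff_remainder dF (divr_gt0 c0 C0)).
have Fu0 : \forall h \near (0 : R), F (u (h + t), h + t) = F (u t, t).
  by move: Fu; rewrite (near_shift 0 t); apply: filterS => h; rewrite /= subr0.
near=> h.
have hn0 : h != 0 by near: h; exact: nbhs_dnbhs_neq.
have hp : 0 < `|h| by rewrite normr_gt0.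
have HFh := near (nbhs_dnbhs HF) h.
have Fuh := near (nbhs_dnbhs Fu0) h.
rewrite -[h *: 1]/(h * 1) mulr1; set eta := u (h + t) - u t.
have dFE : L ('d F (u t, t) (eta, h)) = eta + h *: l.
  have -> : (eta, h) = (eta, 0) + h *: ((0, 1) : V * R).
    apply: injective_projections => /=; first by rewrite scaler0 addr0.
    by rewrite add0r [RHS]mulr1.
  by rewrite linearD/= linearZ/= linearD/= LF linearZ.
have bound : `|eta + h *: l| <= c * (`|eta| + `|h|).
  rewrite -dFE; apply: le_trans (LC _) _.
  rewrite mulrC -ler_pdivlMr// mulrAC.
  have := HFh _; rewrite -/eta.
  rewrite [(eta, h) + _](_ : _ = (u (h + t), h + t)); last first.
    by apply: injective_projections => //=; rewrite /eta subrK.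
  rewrite Fuh// subrr sub0r normrN => Hle; apply: le_trans (Hle _) _ => //.
  rewrite ler_wpM2l ?divr_ge0 ?(ltW c0) ?(ltW C0)//.
  by rewrite prod_normE/= ge_max lerDl lerDr !normr_ge0.
(* Absorbing half of [`|eta|] on the left shows that [u] is Lipschitz at [t]. *)
have eta_le : `|eta| <= (2 * `|l| + 1) * `|h|.
  have : `|eta| <= `|eta + h *: l| + `|h| * `|l|.
    by rewrite -normrZ -{1}(addrK (h *: l) eta) ler_normB.
  have : c * (`|eta| + `|h|) <= 1 / 2 * (`|eta| + `|h|).
    by rewrite ler_wpM2r// addr_ge0.
  by move: bound; lra.
rewrite -[X in `|X - _|](scalerK hn0) -scalerBr normrZ normfV.
rewrite ler_pdivrMl// scalerN -opprD normrN addrC.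
apply: le_trans bound _; rewrite [leRHS]mulrC; apply: le_trans (ler_wpM2r (ltW hp) c2).
rewrite -mulrA ler_wpM2l ?(ltW c0)//.
by move: eta_le; lra.
Unshelve. all: by end_near. Qed.

End ImplicitDerivative.

(** * The evolution equation *)

Section Times.
Context {R : realType}.

Lemma time_oo_co (T : \bar R) (t : R) : time_oo T t -> time_co T t.
Proof. by move=> [t0 tT]; split; [exact: ltW|]. Qed.

Lemma time_co_nbhs (T : \bar R) (t : R) : time_oo T t -> nbhs t (time_co T).
Proof.
move=> [t0 tT]; have t0' : \forall s \near t, 0 < s by exact: lt_nbhsr.
have tT' : \forall s \near t, (s%:E < T)%E.
  case: T tT => [r||]// tr.
  - by rewrite lte_fin in tr; apply: filterS (lt_nbhsl tr) => s; rewrite lte_fin.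
  - by apply: near_everywhere => s; rewrite ltry.
by apply: filterS2 t0' tT' => s s0 sT; split; [exact: ltW|].
Qed.

Lemma mulmxr_continuous (k l : nat) (B : 'M[R]_(k, l)) :
  continuous (fun z : 'rV[R]_k => z *m B).
Proof.
move=> z; rewrite (_ : (fun z => _) = \sum_i (fun z : 'rV[R]_k => z 0 i *: row i B)).
  apply: differentiable_continuous; apply: differentiable_sum => i.
  by apply: differentiableZl; exact: differentiable_coord.
by apply/funext => y; rewrite fct_sumE mulmx_sum_row.
Qed.

(** An interior time can be approached inside [I] from both sides. *)
Lemma derive_within_interior (W : normedModType R) (I : set R) (F f : R -> W)
    (t : R) :
  nbhs t I -> differentiable F t -> (\forall s \near t, I s -> F s = f s) ->
  derive_within I f t 1 = 'd F t 1.
Proof.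
move=> It dF Ff; apply: derive_within_ext => //; last exact: nbhs_singleton It.
apply: Build_ProperFilter => nP.
have nI := near_line (1 : R) It.
have {}nP : \forall h \near (0 : R)^', I (h *: (1 : R) + t) -> False by exact: nP.
have [h [Ih nIh]] := filter_ex (filterI (nbhs_dnbhs nI) nP).
exact: nIh.
Qed.

End Times.

Lemma cvg_to_pair (T : Type) (U V : topologicalType) (F : set_system T)
    (f : T -> U) (g : T -> V) (a : U) (b : V) : Filter F ->
  f @ F --> a -> g @ F --> b -> (fun s => (f s, g s)) @ F --> (a, b).
Proof. by move=> FF fa gb; exact: (cvg_pair fa gb). Qed.

Section SpaceTime.
Context {R : realType}.

(** Fixing the time turns the extension [F] of the space-time function [f] into
    an extension of its restriction to that time. *)
Lemma diff_slice_jacobian (k l : nat) (A : set 'rV[R]_k) (S : set ('rV[R]_k * R))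
    (F f : 'rV[R]_k * R -> 'rV[R]_l) (a : 'rV[R]_k) (t : R) :
  rel_open A -> A a -> (forall b, A b -> S (b, t)) -> differentiable F (a, t) ->
  (\forall z \near (a, t), S z -> F z = f z) ->
  forall h, 'd F (a, t) (h, 0) = h *m jacobian A (fun b => f (b, t)) a.
Proof.
move=> Ao Aa AS dF Ff h.
have ds := is_diff_fst_slice dF.
have dFs : differentiable (fun b => F (b, t)) a := @ex_diff _ _ _ _ _ _ _ ds.
have dE : ('d (fun b => F (b, t)) a : _ -> _) = _ := @diff_val _ _ _ _ _ _ _ ds.
have Ffs : \forall b \near a, A b -> F (b, t) = f (b, t).
  have ct : (b, t) @[b --> a] --> (a, t) by exact: (cvg_to_pair _ cvg_id (cvg_cst _)).
  have : \forall b \near a, S (b, t) -> F (b, t) = f (b, t) := ct _ Ff.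
  by apply: filterS => b H Ab; exact/H/AS.
transitivity ('d (fun b => F (b, t)) a h); first by rewrite dE.
rewrite diff_rV; apply/rowP => j; rewrite summxE !mxE; apply: eq_bigr => i _.
by rewrite !mxE (pderiv_ext i Ao Aa dFs Ffs).
Qed.

Lemma diff_time_slice (V W : normedModType R) (F : V * R -> W) (a : V) (t : R) :
  differentiable F (a, t) ->
  is_diff t (fun s => F (a, s)) (fun r => 'd F (a, t) (0, r)).
Proof.
move=> dF.
have dp : is_diff t (fun s : R => (a, s)) (fun r => (0, r)).
  exact: (@is_diff_pair _ _ _ _ (cst a) 0 id id).
exact: (@is_diff_comp _ _ _ _ _ _ F ('d F (a, t)) t dp (differentiableP dF)).
Qed.

End SpaceTime.

Theorem proposition1 (R : realType) (n d : nat) (hd : (d <= n)%N)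
  (M : manifold R (n - d)%N)
  (M_compact : compact [set: M]) (M_connected : connected [set: M])
  (m : cotensor2 M) (m_metric : riemannian_metric m)
  (T : \bar R) (T_gt0 : (0 < T)%E) (alpha : R) (alpha_gt0 : 0 < alpha)
  (x : R -> M -> 'rV[R]_n)
  (x_smooth : smooth_family_Rn (time_co T) x)
  (x_embedding : forall t, time_co T t -> smooth_embedding (x t))
  (v : 'rV[R]_n -> R -> 'rV[R]_n)
  (v_velocity : velocity_field (time_co T) x v)
  (psi psi_inv : R -> M -> M)
  (psi_smooth : smooth_family (time_co T) psi)
  (psi_diffeo : forall t, time_co T t -> diffeomorphism (psi t) (psi_inv t))
  (psi_flow : harmonic_map_heat_flow alpha (time_oo T)
                (fun t => pullback_euclidean (x t)) m psi) :
  let xhat (t : R) : M -> 'rV[R]_n := x t \o psi_inv t in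
  let ghat (t : R) : cotensor2 M := pullback_euclidean (xhat t) in
  let w (t : R) : vector_components M := deturck_field (ghat t) m in
  forall t, time_oo T t ->
    tangent_field (w t) /\
    forall (p : M) (C : chart R (n - d)%N M), atlas M C -> cdom C p ->
      is_derive t 1 (fun s : R => xhat s p)
        (v (xhat t p) t
         - alpha^-1 *: differential_apply (xhat t) (w t) C p).
Proof.
move=> xhat ghat w t It.
have tI := time_co_nbhs It; have Ict := time_oo_co It.
have psit := psi_diffeo t Ict; have psit' := diffeomorphism_sym psit.
have [[cpsi _] _ psiK psiK'] := psit.
have ximm := embedding_immersion (x_embedding t Ict).
have xhimm : regular_immersion (xhat t) by exact: (immersion_comp psit' ximm).
have greg := immersion_regular xhimm.
have mreg := riemannian_regular m_metric.
split.
  apply: deturck_tangent => //; last exact: riemannian_pullback_id.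
  exact: (pullback_euclidean_comp (diffeomorphism_id M) xhimm).
move=> p C aC Cp.
pose q := psi_inv t p.
have qp : psi t q = p by exact: psiK'.
have [C1 a1 C1q] := atlas_cover q.
pose u s := cmap C1 (psi_inv s p).
pose A := chart_dom (psi t) C1 C; pose Phi := chart_rep (psi t) C1 C.
have Au : A (u t) by apply: chart_dom_cmap => //; rewrite qp.
have Ao : rel_open A by exact: chart_dom_rel_open.
have PhiE : Phi (u t) = cmap C p by rewrite /Phi chart_rep_cmap// qp.
pose J := jacobian A Phi (u t).
have Ju : J \in unitmx by exact: chart_rep_jacobian_unitmx psit a1 aC Au.
have xE : x t = xhat t \o psi t by apply/funext => r; rewrite /xhat/= psiK.
have cinvq : psi_inv s p @[s --> t] --> q.
  apply: (inverse_family_cvg (I := time_co T) (f := psi)) => //.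
  - exact: manifold_hausdorff.
  - by case: psi_smooth.
  - by move=> s /psi_diffeo[].
have cu : u s @[s --> t] --> u t.
  exact: (cvg_comp _ _ cinvq (cmap_cvg a1 C1q)).
have near_dom : \forall s \near t, time_co T s /\ cdom C1 (psi_inv s p).
  by apply: filterI => //; exact: cinvq _ (cdom_nbhs a1 C1q).
(* The local expression of [psi] in space-time; it is constant along the curve
   [s |-> (u s, s)]. *)
pose S := [set z : 'rV[R]_(n - d) * R |
  [/\ cimg C1 z.1, time_co T z.2 & cdom C (psi z.2 (cinv C1 z.1))]].
pose f (z : 'rV[R]_(n - d) * R) := cmap C (psi z.2 (cinv C1 z.1)).
have S0 : S (u t, t).
  by split=> //=; [exact: cimg_cmap|rewrite /u cmapK// qp].
have [F dF Ff] : diff_within S f (u t, t).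
  by apply: smooth_on_diff_within S0; case: psi_smooth => _; exact.
have cut : (u s, s) @[s --> t] --> (u t, t) by exact: (cvg_to_pair _ cu cvg_id).
have Fu s : time_co T s -> cdom C1 (psi_inv s p) ->
    S (u s, s) /\ f (u s, s) = cmap C p.
  move=> Is C1s; have [_ _ _ sK] := psi_diffeo s Is.
  by rewrite /S /f/= /u cmapK// sK; split=> //; split=> //; exact: cimg_cmap.
have Fconst : \forall s \near t, F (u s, s) = F (u t, t).
  have H : \forall s \near t, S (u s, s) -> F (u s, s) = f (u s, s) := cut _ Ff.
  have E s : time_co T s /\ cdom C1 (psi_inv s p) ->
     (S (u s, s) -> F (u s, s) = f (u s, s)) -> F (u s, s) = cmap C p.
    by move=> [Is C1s] Hs; have [Su <-] := Fu s Is C1s; exact: Hs.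
  rewrite (E t)//; last exact: nbhs_singleton H.
  by apply: filterS2 near_dom H => s; exact: E.
have dFspace h : 'd F (u t, t) (h, 0) = h *m J.
  rewrite (diff_slice_jacobian Ao Au _ dF Ff)//.
  by move=> b [Cb Cfb]; split.
have psi_near : \forall s \near t, time_co T s -> cdom C (psi s q).
  have ct : (q, s) @[s --> t] --> (q, t) by exact: (cvg_to_pair _ (cvg_cst _) cvg_id).
  have [/subspace_continuousP cpsi2 _] := psi_smooth.
  have Cq : nbhs (psi t q) (cdom C) by rewrite qp; exact: cdom_nbhs.
  have H : \forall z \near (q, t), time_co T z.2 -> cdom C (psi z.2 z.1).
    exact: cpsi2 (q, t) Ict _ Cq.
  exact: ct _ H.
have dFtime : 'd F (u t, t) (0, 1) = alpha^-1 *: w t C p.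
  have ds := diff_time_slice dF.
  have dE : ('d (fun s => F (u t, s)) t : _ -> _) = _ := @diff_val _ _ _ _ _ _ _ ds.
  have dFs : differentiable (fun s => F (u t, s)) t := @ex_diff _ _ _ _ _ _ _ ds.
  have -> : 'd F (u t, t) (0, 1) = 'D_1 (fun s => cmap C (psi s q)) t.
    transitivity ('D_1 (fun s => F (u t, s)) t); first by rewrite deriveE// dE.
    apply: near_eq_derive.
    have ct : (u t, s) @[s --> t] --> (u t, t).
      exact: (cvg_to_pair _ (cvg_cst _) cvg_id).
    have H : \forall s \near t, S (u t, s) -> F (u t, s) = f (u t, s) := ct _ Ff.
    have N : \forall s \near t, time_co T s /\ cdom C (psi s q).
      apply: filterS2 tI psi_near => s Is Cs; split=> //; exact: Cs.
    apply: filterS2 N H => s [Is Cs] Hs.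
    rewrite Hs; first by rewrite /f/= /u cmapK.
    by split=> //=; rewrite /u ?cmapK//; exact: cimg_cmap.
  rewrite (psi_flow t q C1 C It a1 aC C1q); last by rewrite qp.
  congr (_ *: _).
  rewrite xE (map_laplacian_deturck psit m _ greg) ?qp//.
  - by rewrite -xE; exact: immersion_regular.
  - exact: (pullback_euclidean_comp psit xhimm).
have du : is_derive t 1 u (- (alpha^-1 *: (w t C p *m invmx J))).
  rewrite scalemxAl -dFtime.
  apply: (implicit_derivative (L := mulmxr (invmx J))) => //.
    exact: mulmxr_continuous.
  by move=> h /=; rewrite dFspace mulmxK.
(* The local expression of [x] in space-time; along the same curve it is
   [xhat s p]. *)
pose S' := [set z : 'rV[R]_(n - d) * R | cimg C1 z.1 /\ time_co T z.2].
pose f' (z : 'rV[R]_(n - d) * R) := x z.2 (cinv C1 z.1).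
have S'0 : S' (u t, t) by split=> //=; exact: cimg_cmap.
have [X dX Xf] : diff_within S' f' (u t, t).
  exact: smooth_on_diff_within (x_smooth C1 a1) S'0.
have JE : J *m jacobian (cimg C) (xhat t \o cinv C) (cmap C p) =
    jacobian (cimg C1) (x t \o cinv C1) (u t).
  have [dxh _ _] := xhimm C (Phi (u t)) aC (chart_rep_cimg Au).
  rewrite -PhiE [in RHS]xE; apply/esym.
  exact: (jacobian_chart_comp psit a1 aC Au dxh).
have dXspace h : 'd X (u t, t) (h, 0) =
    h *m (J *m jacobian (cimg C) (xhat t \o cinv C) (cmap C p)).
  rewrite JE (diff_slice_jacobian (cimg_rel_open a1) _ _ dX Xf)//.
  exact: cimg_cmap.
have dXtime : 'd X (u t, t) (0, 1) = v (xhat t p) t.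
  have ds := diff_time_slice dX.
  have dE : ('d (fun s => X (u t, s)) t : _ -> _) = _ := @diff_val _ _ _ _ _ _ _ ds.
  have dXs : differentiable (fun s => X (u t, s)) t := @ex_diff _ _ _ _ _ _ _ ds.
  rewrite v_velocity// (derive_within_interior (F := fun s => X (u t, s)))//.
    by rewrite dE.
  have ct : (u t, s) @[s --> t] --> (u t, t) by exact: (cvg_to_pair _ (cvg_cst _) cvg_id).
  have H : \forall s \near t, S' (u t, s) -> X (u t, s) = f' (u t, s) := ct _ Xf.
  apply: filterS H => s H Is; rewrite H; last by split=> //; exact: cimg_cmap.
  by rewrite /f'/= /u cmapK.
have -> : v (xhat t p) t - alpha^-1 *: differential_apply (xhat t) (w t) C p =
    'd X (u t, t) (- (alpha^-1 *: (w t C p *m invmx J)), 1).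
  have -> : (- (alpha^-1 *: (w t C p *m invmx J)), 1) =
     (- (alpha^-1 *: (w t C p *m invmx J)), 0) + ((0, 1) : 'rV[R]_(n - d) * R).
    by apply: injective_projections; rewrite /= ?addr0 ?add0r.
  rewrite linearD/= dXspace dXtime addrC mulNmx -scalemxAl mulmxA mulmxKV//.
  congr (- (_ *: _) + _); apply/rowP => l; rewrite /differential_apply summxE mxE.
  by apply: eq_bigr => i _; rewrite !mxE.
apply: (near_eq_is_derive (f := fun s => X (u s, s))); last exact: is_diff_curve.
have H : \forall s \near t, S' (u s, s) -> X (u s, s) = f' (u s, s) := cut _ Xf.
apply: filterS2 near_dom H => s [Is C1s] Hs.
rewrite Hs; first by rewrite /f'/= /u cmapK.
by split=> //; exact: cimg_cmap.
Qed.
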